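(* Let $a\in\mathbb{C}$ be such that none of $1\pm a$, $\frac12\pm a$ is a negative integer or zero (i.e. $2a\notin\mathbb{Z}\setminus\{0\}$). Then $${}_6F_{6}\left[ \begin{array}{cccccc} \frac{1}{4}, & \frac{3}{4}, & \frac{1}{4}+a, & \frac{3}{4} + a, & \frac{1}{4}-a, & \frac{3}{4} - a \\ 1, & \frac{1}{2}, & 1-a, & \frac{1}{2}-a, & 1+a, & \frac{1}{2}+a \end{array} \Big| \; 1 \right]$$ $$= \frac{\Gamma(1+2a)\, \Gamma(1-2a)}{4 \pi} \left[ \frac{\Gamma(\frac{1}{4})^2}{\Gamma(\frac{3}{4}-2a)\, \Gamma(\frac{3}{4}+2a)} + \frac{\sqrt{2} \, \pi^2}{\Gamma(a+\frac{5}{8})\, \Gamma(a+\frac{7}{8})\, \Gamma(-a+\frac{5}{8})\, \Gamma(-a+\frac{7}{8}) } \right].$$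
   Context: The classical generalized hypergeometric series is, with the convention used here, $${}_mF_{m}\left[ \begin{array}{ccc} a_1, & \dots, & a_m \\ b_1, & \dots, & b_m \end{array} \Big| \; z \right] :=\sum_{k=0}^{\infty} \frac{(a_1)_k \cdots (a_m)_k}{(b_1)_k \cdots (b_m)_k}\, z^k,$$ where no $b_i$ is a negative integer or zero, $(a)_0:=1$ and $(a)_k:=a(a+1)\cdots(a+k-1)$ for $k\ge1$ (no additional $k!$ in the denominator). $1/\Gamma$ is interpreted as $0$ at the poles of $\Gamma$. *)

(* Defs.v *)
(* Stdlib reals with Coquelicot's complex numbers [C]. *)
From Stdlib Require Import Reals List Factorial ClassicalEpsilon.
From Coquelicot Require Import Coquelicot.
Import ListNotations.
Open Scope R_scope.

Definition nonpos_int (z : C) : Prop := exists n : nat, z = Copp (RtoC (INR n)).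

Fixpoint poch (a : C) (k : nat) : C :=
  match k with
  | O => RtoC 1
  | S j => (poch a j * (a + RtoC (INR j)))%C
  end.

Definition Cprod (l : list C) : C := fold_right Cmult (RtoC 1) l.

(* There is no extra [k!] in the denominator: the usual one has to be supplied
   by a parameter [1] in [bs].  Meaningful when no element of [bs] satisfies
   [nonpos_int]. *)
Definition hyp_term (as_ bs : list C) (z : C) (k : nat) : C :=
  (Cprod (map (fun a => poch a k) as_) / Cprod (map (fun b => poch b k) bs)
   * z ^ k)%C.

(* The series converges in [C] and its sum is [s]. *)
Definition is_hyp (as_ bs : list C) (z s : C) : Prop :=
  @is_series C_AbsRing C_NormedModule (hyp_term as_ bs z) s.

Definition Cexp (z : C) : C :=
  (exp (Re z) * cos (Im z), exp (Re z) * sin (Im z)).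

(* [x ^ z] for a real [x > 0]. *)
Definition Rpower_C (x : R) (z : C) : C := Cexp (z * RtoC (ln x))%C.

(* Limit of a complex sequence, unspecified when the sequence diverges. *)
Definition CLim_seq (u : nat -> C) : C :=
  (real (Lim_seq (fun n => Re (u n))), real (Lim_seq (fun n => Im (u n)))).

Lemma CLim_seq_unique (u : nat -> C) (l : C) :
  filterlim u eventually (@locally C_UniformSpace l) -> CLim_seq u = l.
Proof.
  intros H; destruct l as [x y]; unfold CLim_seq; f_equal.
  - rewrite (is_lim_seq_unique _ (Finite x)); [reflexivity|].
    apply (filterlim_comp _ _ _ u (fun z : C => fst z) _ _ _ H).
    intros P [e He]; exists e; intros [p q] [Hp _]; apply He, Hp.
  - rewrite (is_lim_seq_unique _ (Finite y)); [reflexivity|].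
    apply (filterlim_comp _ _ _ u (fun z : C => snd z) _ _ _ H).
    intros P [e He]; exists e; intros [p q] [_ Hq]; apply He, Hq.
Qed.

(* Euler's limit  Gamma z = lim_k  k! k^(z-1) / (z)_k,  valid at every complex
   number [z] that is not a pole. *)
Definition Gamma (z : C) : C :=
  CLim_seq (fun k =>
    RtoC (INR (fact k)) * Rpower_C (INR k) (z - RtoC 1) / poch z k)%C.

(* The entire function 1 / Gamma, which vanishes at the poles of Gamma. *)
Definition rGamma (z : C) : C :=
  if excluded_middle_informative (nonpos_int z) then RtoC 0 else (/ Gamma z)%C.

(* Main.v *)
(** With b = 2 a, the k-th term is t_(2k), where t_n is the n-th term of the
    well-poised series F(z) = 3F2(1/2, 1/2 + b, 1/2 - b; 1 + b, 1 - b; z) at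
    z = 1, so the sum is (F(1) + F(-1)) / 2.

    Both values come from Whipple's theorem
    3F2(al, 1 - al, c; e, f; 1) with e + f = 1 + 2 c. A Gosper certificate gives
    a first-order recurrence under (c, e, f) -> (c + 2, e + 2, f + 2); the sum
    tends to 1 as c grows, and the infinite product of the ratios is a quotient
    of Gamma values by Euler's limit. F(1) is the case al = 1/2 + b (it is also a
    case of Dixon's theorem). For z = -1, expanding the factor
    (1/2 + b)_n (1/2 - b)_n / ((1 + b)_n (1 - b)_n) of t_n by the Pfaff-Saalschuetz
    sum and exchanging the summations gives Whipple's quadratic transformation
    F(-1) = 2^(-1/2) 3F2(1/4, 3/4, 1/2; 1 + b, 1 - b; 1). The exchange is made
    legitimate by terminating weights for which the inner sum is Vandermonde's.
    The Gamma values are put in the stated form by the duplication formula and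
    Gamma(1/2)^2 = PI, which is Wallis' product. *)
Require Import Defs.
From Stdlib Require Import Reals List Factorial Lra Lia ClassicalEpsilon.
From Coquelicot Require Import Coquelicot.
Import ListNotations.
Open Scope R_scope.

(** * Limits of complex sequences *)

Definition Clim (u : nat -> C) (l : C) : Prop :=
  is_lim_seq (fun n => Re (u n)) (Re l) /\ is_lim_seq (fun n => Im (u n)) (Im l).

Lemma Clim_ext_loc (u v : nat -> C) (l : C) :
  eventually (fun n => u n = v n) -> Clim u l -> Clim v l.
Proof.
  intros H [H1 H2]; split.
  - apply is_lim_seq_ext_loc with (2 := H1).
    apply filter_imp with (2 := H); intros n ->; reflexivity.
  - apply is_lim_seq_ext_loc with (2 := H2).
    apply filter_imp with (2 := H); intros n ->; reflexivity.
Qed.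

Lemma Clim_ext (u v : nat -> C) (l : C) :
  (forall n, u n = v n) -> Clim u l -> Clim v l.
Proof. intros H; apply Clim_ext_loc; exists O; auto. Qed.

Lemma Clim_const (l : C) : Clim (fun _ => l) l.
Proof. split; apply is_lim_seq_const. Qed.

Lemma Clim_RtoC (u : nat -> R) (l : R) :
  is_lim_seq u l -> Clim (fun n => RtoC (u n)) (RtoC l).
Proof. intros H; split; [exact H | apply is_lim_seq_const]. Qed.

Lemma Clim_plus (u v : nat -> C) (l m : C) :
  Clim u l -> Clim v m -> Clim (fun n => u n + v n)%C (l + m)%C.
Proof. intros [H1 H2] [H3 H4]; split; apply is_lim_seq_plus'; assumption. Qed.

Lemma Clim_opp (u : nat -> C) (l : C) : Clim u l -> Clim (fun n => - u n)%C (- l)%C.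
Proof.
  intros [H1 H2]; split.
  - now apply (is_lim_seq_opp _ (Finite _)) in H1.
  - now apply (is_lim_seq_opp _ (Finite _)) in H2.
Qed.

Lemma Clim_minus (u v : nat -> C) (l m : C) :
  Clim u l -> Clim v m -> Clim (fun n => u n - v n)%C (l - m)%C.
Proof. intros; apply Clim_plus, Clim_opp; assumption. Qed.

Lemma Clim_mult (u v : nat -> C) (l m : C) :
  Clim u l -> Clim v m -> Clim (fun n => u n * v n)%C (l * m)%C.
Proof.
  intros [H1 H2] [H3 H4]; split.
  - apply is_lim_seq_minus'; apply is_lim_seq_mult'; assumption.
  - apply is_lim_seq_plus'; apply is_lim_seq_mult'; assumption.
Qed.

Lemma Clim_inv (u : nat -> C) (l : C) :
  l <> RtoC 0 -> Clim u l -> Clim (fun n => / u n)%C (/ l)%C.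
Proof.
  intros Hl [H1 H2].
  assert (Hd : Re l ^ 2 + Im l ^ 2 <> 0).
  { intros E; apply Hl; destruct l as [x y]; simpl in E; unfold RtoC; f_equal; nra. }
  assert (HD : is_lim_seq (fun n => Re (u n) ^ 2 + Im (u n) ^ 2) (Re l ^ 2 + Im l ^ 2)).
  { apply is_lim_seq_plus'.
    - simpl; repeat apply is_lim_seq_mult'; try assumption; apply is_lim_seq_const.
    - simpl; repeat apply is_lim_seq_mult'; try assumption; apply is_lim_seq_const. }
  split.
  - apply is_lim_seq_div'; assumption.
  - apply is_lim_seq_div'; try assumption.
    now apply (is_lim_seq_opp _ (Finite _)) in H2.
Qed.

Lemma Clim_unique (u : nat -> C) (l m : C) : Clim u l -> Clim u m -> l = m.
Proof.
  intros [H1 H2] [H3 H4].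
  apply is_lim_seq_unique in H1, H2, H3, H4.
  rewrite H1 in H3; rewrite H2 in H4; injection H3; injection H4; intros.
  destruct l, m; simpl in *; congruence.
Qed.

Lemma Clim_subseq (u : nat -> C) (l : C) (phi : nat -> nat) :
  (forall n, (n <= phi n)%nat) -> Clim u l -> Clim (fun n => u (phi n)) l.
Proof.
  intros Hphi [H1 H2].
  assert (F : filterlim phi eventually eventually).
  { intros P [N HN]; exists N; intros n Hn; apply HN; specialize (Hphi n); lia. }
  split.
  - exact (is_lim_seq_subseq (fun n => Re (u n)) _ phi F H1).
  - exact (is_lim_seq_subseq (fun n => Im (u n)) _ phi F H2).
Qed.

Lemma Clim_incr_1 (u : nat -> C) (l : C) : Clim (fun n => u (S n)) l -> Clim u l.
Proof. intros [H1 H2]; split; apply is_lim_seq_incr_1; assumption. Qed.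

Lemma Clim_CLim_seq (u : nat -> C) (l : C) : Clim u l -> CLim_seq u = l.
Proof.
  intros [H1 H2]; unfold CLim_seq.
  rewrite (is_lim_seq_unique _ _ H1), (is_lim_seq_unique _ _ H2).
  destruct l; reflexivity.
Qed.

Lemma im_le_Cmod (c : C) : Rabs (Im c) <= Cmod c.
Proof.
  eapply Rle_trans; [|apply Rmax_Cmod]; apply Rmax_r.
Qed.

Lemma Clim_le (u : nat -> C) (l : C) (e : nat -> R) :
  eventually (fun n => Cmod (u n - l) <= e n) -> is_lim_seq e 0 -> Clim u l.
Proof.
  intros H He.
  assert (K : forall f : nat -> R, eventually (fun n => Rabs (f n) <= e n) -> is_lim_seq f 0).
  { intros f Hf; apply is_lim_seq_abs_0.
    apply is_lim_seq_le_le_loc with (u := fun _ => 0) (w := e);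
      [|apply is_lim_seq_const | exact He].
    apply filter_imp with (2 := Hf); intros n Hn; split; [apply Rabs_pos | exact Hn]. }
  split.
  - apply is_lim_seq_ext with (u := fun n => Re (u n - l) + Re l).
    + intros n; unfold Re, Im; simpl; ring.
    + replace (Finite (Re l)) with (Finite (0 + Re l)) by (f_equal; ring).
      apply is_lim_seq_plus'; [|apply is_lim_seq_const].
      apply K; apply filter_imp with (2 := H); intros n Hn.
      eapply Rle_trans; [apply re_le_Cmod | exact Hn].
  - apply is_lim_seq_ext with (u := fun n => Im (u n - l) + Im l).
    + intros n; unfold Re, Im; simpl; ring.
    + replace (Finite (Im l)) with (Finite (0 + Im l)) by (f_equal; ring).
      apply is_lim_seq_plus'; [|apply is_lim_seq_const].
      apply K; apply filter_imp with (2 := H); intros n Hn.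
      eapply Rle_trans; [apply im_le_Cmod | exact Hn].
Qed.

Lemma Clim_Cmod (u : nat -> C) (l : C) : Clim u l -> is_lim_seq (fun n => Cmod (u n)) (Cmod l).
Proof.
  intros [H1 H2]; unfold Cmod.
  apply is_lim_seq_continuous with (f := sqrt) (u := fun n => fst (u n) ^ 2 + snd (u n) ^ 2).
  - apply continuity_pt_sqrt, Rplus_le_le_0_compat; apply pow2_ge_0.
  - apply is_lim_seq_plus'; simpl; repeat apply is_lim_seq_mult';
      try assumption; apply is_lim_seq_const.
Qed.

Lemma is_lim_seq_bounded (u : nat -> R) (l : R) :
  is_lim_seq u l -> exists M, forall n, Rabs (u n) <= M.
Proof.
  intros H.
  destruct (filterlim_bounded (V := R_NormedModule) u) as [M HM].
  - exists l; exact H.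
  - exists M; exact HM.
Qed.

Lemma Clim_bounded (u : nat -> C) (l : C) :
  Clim u l -> exists M, 0 < M /\ forall n, Cmod (u n) <= M.
Proof.
  intros H; destruct (is_lim_seq_bounded _ _ (Clim_Cmod _ _ H)) as [M HM].
  exists (M + 1); split.
  - specialize (HM O); pose proof (Rabs_pos (Cmod (u O))); lra.
  - intros n; specialize (HM n); pose proof (Rle_abs (Cmod (u n))); lra.
Qed.

Fixpoint Csum (a : nat -> C) (n : nat) : C :=
  match n with
  | O => RtoC 0
  | S m => (Csum a m + a m)%C
  end.

Lemma Csum_sum_n (a : nat -> C) (n : nat) : Csum a (S n) = @sum_n C_AbelianMonoid a n.
Proof.
  induction n as [|n IH].
  - rewrite sum_O; simpl; ring.
  - rewrite sum_Sn, <- IH; reflexivity.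
Qed.

Lemma is_series_Clim (a : nat -> C) (s : C) :
  @is_series C_AbsRing C_NormedModule a s <-> Clim (Csum a) s.
Proof.
  unfold is_series; split.
  - intros H; apply Clim_incr_1.
    apply Clim_ext with (u := @sum_n C_AbelianMonoid a).
    { intros n; symmetry; apply Csum_sum_n. }
    split.
    + apply (filterlim_comp _ _ _ _ (fun z : C => fst z) _ _ _ H).
      intros P [e He]; exists e; intros [p q] [Hp _]; apply He, Hp.
    + apply (filterlim_comp _ _ _ _ (fun z : C => snd z) _ _ _ H).
      intros P [e He]; exists e; intros [p q] [_ Hp]; apply He, Hp.
  - intros H0.
    assert (H : Clim (@sum_n C_AbelianMonoid a) s).
    { apply Clim_ext with (u := fun n => Csum a (S n)); [intros n; apply Csum_sum_n|].
      apply (Clim_subseq _ _ S); [lia | exact H0]. }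
    destruct H as [H1 H2]; intros P [e He].
    assert (E1 := H1 (ball (Re s) e) (locally_ball _ _)).
    assert (E2 := H2 (ball (Im s) e) (locally_ball _ _)).
    unfold filtermap in *.
    apply filter_imp with (2 := filter_and _ _ E1 E2).
    intros n [K1 K2]; apply He; split; assumption.
Qed.

Lemma Clim_of_factors (v : nat -> C) (e : nat -> R) :
  (forall k, Cmod (v (S k) - v k) <= e k * Cmod (v k)) -> (forall k, 0 <= e k) ->
  ex_series e -> exists l, Clim v l.
Proof.
  intros Hv He [E HE].
  assert (HS : forall n, sum_n e n <= E).
  { intros n; apply is_lim_seq_incr_compare with (1 := HE).
    intros k; rewrite sum_Sn; unfold plus; simpl; specialize (He (S k)); lra. }
  assert (B : forall n, Cmod (v (S n)) <= Cmod (v O) * exp (sum_n e n)).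
  { assert (T : forall k, Cmod (v (S k)) <= (1 + e k) * Cmod (v k)).
    { intros k; replace (v (S k)) with (v k + (v (S k) - v k))%C by ring.
      eapply Rle_trans; [apply Cmod_triangle|].
      replace (v k + (v (S k) - v k))%C with (v (S k)) by ring.
      specialize (Hv k); lra. }
    assert (X : forall x, 1 + x <= exp x) by (intros x; apply exp_ineq1_le).
    induction n as [|n IH].
    - rewrite sum_O; eapply Rle_trans; [apply T|].
      rewrite Rmult_comm; apply Rmult_le_compat_l; [apply Cmod_ge_0 | apply X].
    - rewrite sum_Sn; unfold plus; simpl; rewrite exp_plus.
      eapply Rle_trans; [apply T|].
      replace (Cmod (v O) * (exp (sum_n e n) * exp (e (S n))))
        with (exp (e (S n)) * (Cmod (v O) * exp (sum_n e n))) by ring.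
      apply Rmult_le_compat; [specialize (He (S n)); lra | apply Cmod_ge_0 | apply X | exact IH]. }
  set (M := Cmod (v O) * exp E + Cmod (v O)).
  assert (BM : forall n, Cmod (v n) <= M).
  { pose proof (Cmod_ge_0 (v O)); pose proof (exp_pos E).
    intros [|n]; unfold M; [nra|].
    eapply Rle_trans; [apply B|].
    assert (exp (sum_n e n) <= exp E).
    { destruct (HS n) as [L|L]; [left; apply exp_increasing, L | rewrite L; right; reflexivity]. }
    nra. }
  destruct (ex_series_le (K := C_AbsRing) (V := C_CompleteNormedModule)
    (fun k => v (S k) - v k)%C (fun k => M * e k)) as [l Hl].
  - intros k; change (Cmod (v (S k) - v k) <= M * e k).
    eapply Rle_trans; [apply Hv|].
    rewrite Rmult_comm; apply Rmult_le_compat_r; [apply He | apply BM].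
  - exists (M * E); apply (is_series_scal_l M e E HE).
  - apply is_series_Clim in Hl.
    exists (l + v O)%C.
    apply Clim_ext with (2 := Clim_plus _ _ _ _ Hl (Clim_const (v O))).
    induction n as [|n IH]; simpl; [ring|].
    replace (Csum (fun k => v (S k) - v k)%C n) with (v n - v O)%C by (rewrite <- IH; ring).
    ring.
Qed.

(** * Complex powers *)

Lemma Cmod_le_abs (z : C) : Cmod z <= Rabs (Re z) + Rabs (Im z).
Proof.
  destruct z as [x y]; unfold Re, Im; simpl.
  replace (x, y) with (RtoC x + RtoC y * Ci)%C.
  - eapply Rle_trans; [apply Cmod_triangle|].
    rewrite Cmod_mult, Cmod_Ci, !Cmod_R; lra.
  - unfold RtoC, Cplus, Cmult, Ci; simpl; f_equal; ring.
Qed.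

Lemma Cexp_plus (z w : C) : Cexp (z + w)%C = (Cexp z * Cexp w)%C.
Proof.
  unfold Cexp; destruct z as [a b], w as [c d]; unfold Re, Im, Cplus, Cmult; simpl.
  rewrite exp_plus, cos_plus, sin_plus; f_equal; ring.
Qed.

Lemma Cexp_0 : Cexp (RtoC 0) = RtoC 1.
Proof. unfold Cexp, Re, Im; simpl; rewrite exp_0, cos_0, sin_0; unfold RtoC; f_equal; ring. Qed.

Lemma Cexp_neq_0 (z : C) : Cexp z <> RtoC 0.
Proof.
  intros H; apply (f_equal (fun w => w * Cexp (- z))%C) in H.
  rewrite <- Cexp_plus in H.
  replace (z + - z)%C with (RtoC 0) in H by ring.
  rewrite Cexp_0 in H.
  replace (0 * Cexp (- z))%C with (RtoC 0) in H by ring.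
  apply RtoC_inj in H; lra.
Qed.

Lemma Cexp_RtoC (x : R) : Cexp (RtoC x) = RtoC (exp x).
Proof. unfold Cexp, Re, Im; simpl; rewrite cos_0, sin_0; unfold RtoC; f_equal; ring. Qed.

Lemma Rpower_C_plus (x : R) (z w : C) : Rpower_C x (z + w)%C = (Rpower_C x z * Rpower_C x w)%C.
Proof. unfold Rpower_C; rewrite <- Cexp_plus; f_equal; ring. Qed.

Lemma Rpower_C_mult (x y : R) (z : C) :
  0 < x -> 0 < y -> Rpower_C (x * y) z = (Rpower_C x z * Rpower_C y z)%C.
Proof.
  intros Hx Hy; unfold Rpower_C; rewrite <- Cexp_plus, ln_mult, RtoC_plus by assumption.
  f_equal; ring.
Qed.

Lemma Rpower_C_0 (x : R) : Rpower_C x (RtoC 0) = RtoC 1.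
Proof. unfold Rpower_C; rewrite <- Cexp_0; f_equal; ring. Qed.

Lemma Rpower_C_1 (x : R) : 0 < x -> Rpower_C x (RtoC 1) = RtoC x.
Proof.
  intros Hx; unfold Rpower_C.
  replace (1 * ln x)%C with (RtoC (ln x)) by ring.
  rewrite Cexp_RtoC, exp_ln; auto.
Qed.

Lemma Rpower_C_neq_0 (x : R) (z : C) : Rpower_C x z <> RtoC 0.
Proof. apply Cexp_neq_0. Qed.

Lemma Rpower_C_RtoC (x y : R) : Rpower_C x (RtoC y) = RtoC (Rpower x y).
Proof. unfold Rpower_C, Rpower; rewrite <- RtoC_mult; apply Cexp_RtoC. Qed.

(* By the mean value theorem: the derivative of [(1 + z h) (1 + h)^(-z)] in [h] is [O(h)]. *)
Lemma euler_factor_bound (z : C) : exists K, 0 <= K /\ forall h, 0 <= h <= 1 ->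
  Cmod ((1 + z * RtoC h) * Rpower_C (1 + h) (- z) - 1)%C <= K * (h * h).
Proof.
  destruct z as [x y].
  set (E := fun h => exp (- x * ln (1 + h))).
  set (A := x - x * x + y * y); set (B := y - 2 * x * y).
  set (fr := fun h => E h * ((1 + x * h) * cos (y * ln (1 + h)) + y * h * sin (y * ln (1 + h)))).
  set (fi := fun h => E h * (y * h * cos (y * ln (1 + h)) - (1 + x * h) * sin (y * ln (1 + h)))).
  set (dr := fun h => E h * (h / (1 + h)) * (cos (y * ln (1 + h)) * A + sin (y * ln (1 + h)) * B)).
  set (di := fun h => E h * (h / (1 + h)) * (cos (y * ln (1 + h)) * B - sin (y * ln (1 + h)) * A)).
  assert (Dr : forall h, 0 <= h -> is_derive fr h (dr h)).
  { intros h Hh; unfold fr, dr, E, A, B; auto_derive; [lra | field; lra]. }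
  assert (Di : forall h, 0 <= h -> is_derive fi h (di h)).
  { intros h Hh; unfold fi, di, E, A, B; auto_derive; [lra | field; lra]. }
  set (M := exp (Rabs x * ln 2) * (Rabs A + Rabs B)).
  assert (BE : forall h, 0 <= h <= 1 -> E h <= exp (Rabs x * ln 2)).
  { intros h Hh; unfold E.
    assert (L : 0 <= ln (1 + h) <= ln 2).
    { split; [rewrite <- ln_1; apply ln_le; lra | apply ln_le; lra]. }
    assert (- x * ln (1 + h) <= Rabs x * ln 2).
    { pose proof (Rle_abs (- x)); rewrite Rabs_Ropp in H.
      apply Rle_trans with (Rabs x * ln (1 + h)); [apply Rmult_le_compat_r; lra|].
      apply Rmult_le_compat_l; [apply Rabs_pos | lra]. }
    destruct H as [H|H]; [left; apply exp_increasing, H | rewrite H; right; reflexivity]. }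
  assert (Bd : forall h c s U V, 0 <= h <= 1 -> Rabs c <= 1 -> Rabs s <= 1 ->
    Rabs U + Rabs V = Rabs A + Rabs B ->
    Rabs (E h * (h / (1 + h)) * (c * U + s * V)) <= M * h).
  { intros h c s U V Hh Hc Hs HUV.
    assert (Hq : 0 <= h / (1 + h) <= h).
    { split; [apply Rdiv_le_0_compat; lra|].
      apply Rmult_le_reg_r with (1 + h); [lra|]; unfold Rdiv.
      rewrite Rmult_assoc, Rinv_l; nra. }
    rewrite Rabs_mult, (Rabs_pos_eq (E h * _)).
    2: { apply Rmult_le_pos; [left; apply exp_pos | lra]. }
    unfold M.
    replace (exp (Rabs x * ln 2) * (Rabs A + Rabs B) * h)
      with ((exp (Rabs x * ln 2) * h) * (Rabs A + Rabs B)) by ring.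
    apply Rmult_le_compat.
    - apply Rmult_le_pos; [left; apply exp_pos | lra].
    - apply Rabs_pos.
    - apply Rmult_le_compat; try lra; [left; apply exp_pos | apply BE, Hh].
    - rewrite <- HUV; eapply Rle_trans; [apply Rabs_triang|].
      rewrite !Rabs_mult; pose proof (Rabs_pos U); pose proof (Rabs_pos V); nra. }
  assert (HM : 0 <= M).
  { unfold M; apply Rmult_le_pos; [left; apply exp_pos|].
    pose proof (Rabs_pos A); pose proof (Rabs_pos B); lra. }
  assert (Bc : forall t, Rabs (cos t) <= 1).
  { intros t; apply Rabs_le, COS_bound. }
  assert (Bs : forall t, Rabs (sin t) <= 1).
  { intros t; apply Rabs_le, SIN_bound. }
  assert (MV : forall f df h, 0 <= h <= 1 -> (forall t, 0 <= t -> is_derive f t (df t)) ->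
    (forall t, 0 <= t <= 1 -> Rabs (df t) <= M * t) -> Rabs (f h - f 0) <= M * (h * h)).
  { intros f df h Hh Hd Hb.
    destruct (MVT_gen f 0 h df) as [c [Hc Ec]].
    - intros t; rewrite Rmin_left, Rmax_right by lra; intros; apply Hd; lra.
    - intros t; rewrite Rmin_left, Rmax_right by lra; intros.
      apply derivable_continuous_pt.
      exists (df t); apply is_derive_Reals, Hd; lra.
    - rewrite Rmin_left, Rmax_right in Hc by lra.
      rewrite Ec, Rminus_0_r, Rabs_mult, (Rabs_pos_eq h) by lra.
      rewrite <- Rmult_assoc; apply Rmult_le_compat_r; [lra|].
      eapply Rle_trans; [apply Hb; lra|]; apply Rmult_le_compat_l; lra. }
  exists (2 * M); split; [lra|]; intros h Hh.
  assert (Z : E 0 = 1).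
  { unfold E; rewrite Rplus_0_r, ln_1, Rmult_0_r; apply exp_0. }
  assert (Fr := MV fr dr h Hh Dr).
  assert (Fi := MV fi di h Hh Di).
  eapply Rle_trans; [apply Cmod_le_abs|].
  replace (Re _) with (fr h - fr 0).
  2: { unfold fr at 2; rewrite Z, Rplus_0_r, ln_1, !Rmult_0_r, cos_0, sin_0.
       unfold fr, E, Rpower_C, Cexp, Re, Im; simpl.
       replace ((- x * ln (1 + h) - - y * 0)) with (- x * ln (1 + h)) by ring.
       replace ((- x * 0 + - y * ln (1 + h))) with (- (y * ln (1 + h))) by ring.
       rewrite cos_neg, sin_neg; ring. }
  replace (Im _) with (fi h - fi 0).
  2: { unfold fi at 2; rewrite Z, Rplus_0_r, ln_1, !Rmult_0_r, cos_0, sin_0.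
       unfold fi, E, Rpower_C, Cexp, Re, Im; simpl.
       replace ((- x * ln (1 + h) - - y * 0)) with (- x * ln (1 + h)) by ring.
       replace ((- x * 0 + - y * ln (1 + h))) with (- (y * ln (1 + h))) by ring.
       rewrite cos_neg, sin_neg; ring. }
  assert (Rabs (fr h - fr 0) <= M * (h * h)).
  { apply Fr; intros t Ht; unfold dr; apply Bd; auto. }
  assert (Rabs (fi h - fi 0) <= M * (h * h)).
  { apply Fi; intros t Ht; unfold di.
    replace (cos (y * ln (1 + t)) * B - sin (y * ln (1 + t)) * A)
      with (cos (y * ln (1 + t)) * B + sin (y * ln (1 + t)) * - A) by ring.
    apply Bd; auto; rewrite Rabs_Ropp; ring. }
  lra.
Qed.

(** * Euler's limit for Gamma *)

Lemma sum_Sn_R (a : nat -> R) (n : nat) : sum_n a (S n) = sum_n a n + a (S n).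
Proof. exact (sum_Sn (G := R_AbelianMonoid) a n). Qed.

Lemma ex_series_three_halves : ex_series (fun n => / (INR (S n) * sqrt (INR (S n)))).
Proof.
  assert (P : forall n, 0 < INR (S n)) by (intros; apply lt_0_INR; lia).
  assert (Q : forall n, 0 < sqrt (INR (S n))) by (intros; apply sqrt_lt_R0, P).
  assert (B : forall n, sum_n (fun n => / (INR (S n) * sqrt (INR (S n)))) n
                        <= 3 - 2 / sqrt (INR (S n))).
  { induction n as [|n IH].
    - rewrite sum_O; simpl; rewrite sqrt_1; lra.
    - rewrite sum_Sn_R.
      pose proof (Q n) as Hp; pose proof (Q (S n)) as Hq.
      assert (Ep := sqrt_sqrt (INR (S n)) (Rlt_le _ _ (P n))).
      assert (Eq := sqrt_sqrt (INR (S (S n))) (Rlt_le _ _ (P (S n)))).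
      assert (E : INR (S (S n)) = INR (S n) + 1) by apply S_INR.
      set (p := sqrt (INR (S n))) in *; set (q := sqrt (INR (S (S n)))) in *.
      assert (Epq : q * q = p * p + 1) by lra.
      assert (Hpq : p <= q) by nra.
      assert (K : / (q * q * q) <= 2 / p - 2 / q).
      { replace (2 / p - 2 / q) with (2 * (q - p) / (p * q)) by (field; lra).
        replace (q - p) with (/ (p + q)).
        2: { apply Rmult_eq_reg_l with (p + q); [|lra]; rewrite Rinv_r; nra. }
        replace (2 * / (p + q) / (p * q)) with (/ ((p * q) * (p + q) / 2)) by (field; lra).
        apply Rinv_le_contravar.
        - apply Rdiv_lt_0_compat; [|lra]; repeat apply Rmult_lt_0_compat; lra.
        - apply Rle_trans with (q * q * (q + q) / 2); [|right; field].
          apply Rmult_le_compat_r; [lra|].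
          apply Rmult_le_compat; nra. }
      replace (INR (S (S n)) * q) with (q * q * q) by (rewrite Eq; ring).
      lra. }
  destruct (ex_finite_lim_seq_incr
    (sum_n (fun n => / (INR (S n) * sqrt (INR (S n))))) 3) as [l Hl].
  - intros n; rewrite sum_Sn_R.
    assert (0 < / (INR (S (S n)) * sqrt (INR (S (S n))))).
    { apply Rinv_0_lt_compat, Rmult_lt_0_compat; auto. }
    lra.
  - intros n; eapply Rle_trans; [apply B|].
    assert (0 < 2 / sqrt (INR (S n))) by (apply Rdiv_lt_0_compat; [lra | apply Q]); lra.
  - exists l; exact Hl.
Qed.

Lemma ex_series_inv_sqr : ex_series (fun n => / INR (S n) * / INR (S n)).
Proof.
  apply (ex_series_le (K := R_AbsRing) (V := R_CompleteNormedModule)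
    _ (fun n => / (INR (S n) * sqrt (INR (S n))))); [|exact ex_series_three_halves].
  intros n.
  assert (P : 0 < INR (S n)) by (apply lt_0_INR; lia).
  assert (P1 : 1 <= INR (S n)) by (rewrite S_INR; pose proof (pos_INR n); lra).
  change (Rabs (/ INR (S n) * / INR (S n)) <= / (INR (S n) * sqrt (INR (S n)))).
  rewrite <- Rinv_mult, Rabs_pos_eq.
  2: { left; apply Rinv_0_lt_compat; nra. }
  apply Rinv_le_contravar.
  - apply Rmult_lt_0_compat; [|apply sqrt_lt_R0]; lra.
  - apply Rmult_le_compat_l; [lra|].
    rewrite <- (sqrt_square (INR (S n))) at 2 by lra.
    apply sqrt_le_1_alt; nra.
Qed.

Lemma nonpos_int_plus (z : C) (n : nat) : ~ nonpos_int z -> ~ nonpos_int (z + RtoC (INR n))%C.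
Proof.
  intros H [m Hm]; apply H; exists (n + m)%nat.
  rewrite plus_INR, RtoC_plus.
  replace z with (z + RtoC (INR n) - RtoC (INR n))%C by ring.
  rewrite Hm; ring.
Qed.

Lemma nonpos_int_neq_0 (z : C) (n : nat) : ~ nonpos_int z -> (z + RtoC (INR n))%C <> RtoC 0.
Proof.
  intros H E; apply H; exists n.
  replace z with (z + RtoC (INR n) - RtoC (INR n))%C by ring.
  rewrite E; ring.
Qed.

Lemma poch_neq_0 (z : C) (n : nat) : ~ nonpos_int z -> poch z n <> RtoC 0.
Proof.
  intros H; induction n as [|n IH]; simpl.
  - intros E; apply RtoC_inj in E; lra.
  - apply Cmult_neq_0; [exact IH | apply nonpos_int_neq_0, H].
Qed.

Lemma poch_nonpos_int (m n : nat) : (m < n)%nat -> poch (- RtoC (INR m))%C n = RtoC 0.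
Proof.
  induction n as [|n IH]; [lia|]; intros H; simpl.
  destruct (Nat.eq_dec m n) as [->|].
  - ring.
  - rewrite IH by lia; ring.
Qed.

Lemma RtoC_INR_neq_0 (n : nat) : RtoC (INR (S n)) <> RtoC 0.
Proof. intros E; apply RtoC_inj in E; revert E; apply not_0_INR; lia. Qed.

Lemma RtoC_fact_neq_0 (n : nat) : RtoC (INR (fact n)) <> RtoC 0.
Proof. intros E; apply RtoC_inj in E; revert E; apply INR_fact_neq_0. Qed.

(* The reciprocal of Euler's sequence for [Gamma z], at index [n + 1]. *)
Definition rG (z : C) (n : nat) : C :=
  (poch z (S n) / RtoC (INR (fact (S n))) * Rpower_C (INR (S n)) (1 - z))%C.

Definition rG_ratio (z : C) (n : nat) : C :=
  ((1 + z * RtoC (/ INR (S n))) * Rpower_C (1 + / INR (S n)) (- z))%C.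

Lemma rG_S (z : C) (n : nat) : rG z (S n) = (rG z n * rG_ratio z n)%C.
Proof.
  assert (P : 0 < INR (S n)) by (apply lt_0_INR; lia).
  assert (Q : 0 < / INR (S n)) by (apply Rinv_0_lt_compat, P).
  unfold rG, rG_ratio.
  replace (INR (S (S n))) with (INR (S n) * (1 + / INR (S n))).
  2: { rewrite (S_INR (S n)); field; lra. }
  rewrite Rpower_C_mult by lra.
  replace (1 - z)%C with (RtoC 1 + - z)%C at 2 by ring.
  rewrite (Rpower_C_plus (1 + / INR (S n))), Rpower_C_1 by lra.
  change (poch z (S (S n))) with (poch z (S n) * (z + RtoC (INR (S n))))%C.
  change (fact (S (S n))) with (S (S n) * fact (S n))%nat.
  rewrite mult_INR, (S_INR (S n)).
  pose proof (RtoC_INR_neq_0 n); pose proof (RtoC_fact_neq_0 (S n)).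
  assert (RtoC (INR (S n)) + RtoC 1 <> RtoC 0)%C.
  { rewrite <- RtoC_plus; intros E; apply RtoC_inj in E; lra. }
  rewrite !RtoC_mult, !RtoC_plus, RtoC_inv by lra.
  field; auto.
Qed.

Lemma rG_ratio_bound (z : C) : exists K, 0 <= K /\
  forall n, Cmod (rG_ratio z n - 1)%C <= K * (/ INR (S n) * / INR (S n)).
Proof.
  destruct (euler_factor_bound z) as [K [HK H]]; exists K; split; [exact HK|].
  intros n; apply H.
  assert (1 <= INR (S n)) by (rewrite S_INR; pose proof (pos_INR n); lra).
  split; [left; apply Rinv_0_lt_compat; lra|].
  rewrite <- Rinv_1; apply Rinv_le_contravar; lra.
Qed.

Lemma ex_lim_rG (z : C) : exists l, Clim (rG z) l.
Proof.
  destruct (rG_ratio_bound z) as [K [HK H]].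
  apply Clim_of_factors with (e := fun n => K * (/ INR (S n) * / INR (S n))).
  - intros n; rewrite rG_S.
    replace (rG z n * rG_ratio z n - rG z n)%C with ((rG_ratio z n - 1) * rG z n)%C by ring.
    rewrite Cmod_mult; apply Rmult_le_compat_r; [apply Cmod_ge_0 | apply H].
  - intros n; apply Rmult_le_pos; [exact HK | apply Rle_0_sqr].
  - destruct ex_series_inv_sqr as [s Hs]; exists (K * s); apply (is_series_scal_l K _ s Hs).
Qed.

Lemma rG_neq_0 (z : C) (n : nat) : ~ nonpos_int z -> rG z n <> RtoC 0.
Proof.
  intros H; unfold rG; apply Cmult_neq_0; [apply Cmult_neq_0|].
  - apply poch_neq_0, H.
  - intros E; apply (RtoC_fact_neq_0 (S n)).
    rewrite <- (Cmult_1_l (RtoC _)), <- (Cinv_r (RtoC (INR (fact (S n))))) by apply RtoC_fact_neq_0.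
    rewrite E; ring.
  - apply Rpower_C_neq_0.
Qed.

Lemma ex_lim_inv_rG (z : C) : ~ nonpos_int z -> exists l, Clim (fun n => / rG z n)%C l.
Proof.
  intros Hz; destruct (rG_ratio_bound z) as [K [HK H]].
  assert (N : forall n, rG_ratio z n <> RtoC 0).
  { intros n E; apply (rG_neq_0 z (S n) Hz); rewrite rG_S, E; ring. }
  assert (L : Clim (rG_ratio z) (RtoC 1)).
  { apply Clim_le with (e := fun n => K * (/ INR (S n) * / INR (S n))).
    - exists O; intros n _; apply H.
    - replace (Finite 0) with (Rbar_mult (Finite K) (Finite 0)) by (simpl; f_equal; ring).
      apply is_lim_seq_scal_l.
      apply (ex_series_lim_0 _ ex_series_inv_sqr). }
  apply Clim_inv in L.
  2: { intros E; apply RtoC_inj in E; lra. }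
  destruct (Clim_bounded _ _ L) as [M [HM BM]].
  apply Clim_of_factors with (e := fun n => (M * K) * (/ INR (S n) * / INR (S n))).
  - intros n; rewrite rG_S.
    pose proof (rG_neq_0 z n Hz); pose proof (N n).
    replace (/ (rG z n * rG_ratio z n) - / rG z n)%C
      with (/ rG_ratio z n * - (rG_ratio z n - 1) * / rG z n)%C by (field; auto).
    rewrite !Cmod_mult, Cmod_opp; apply Rmult_le_compat_r; [apply Cmod_ge_0|].
    rewrite Rmult_assoc; apply Rmult_le_compat; try apply Cmod_ge_0; auto.
  - intros n; apply Rmult_le_pos; [nra | apply Rle_0_sqr].
  - destruct ex_series_inv_sqr as [s Hs]; exists ((M * K) * s); apply (is_series_scal_l (M * K) _ s Hs).
Qed.

Lemma Gamma_lim (z : C) : ~ nonpos_int z -> Clim (fun n => / rG z n)%C (Gamma z).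
Proof.
  intros Hz; destruct (ex_lim_inv_rG z Hz) as [l Hl].
  replace (Gamma z) with l; [exact Hl|].
  symmetry; unfold Gamma; apply Clim_CLim_seq, Clim_incr_1.
  apply Clim_ext with (2 := Hl); intros n; unfold rG.
  pose proof (poch_neq_0 z (S n) Hz); pose proof (RtoC_fact_neq_0 (S n)).
  pose proof (Rpower_C_neq_0 (INR (S n)) (1 - z)).
  replace (Rpower_C (INR (S n)) (z - 1)) with (/ Rpower_C (INR (S n)) (1 - z))%C.
  - field; auto.
  - assert (E : (Rpower_C (INR (S n)) (z - 1) * Rpower_C (INR (S n)) (1 - z))%C = RtoC 1).
    { rewrite <- Rpower_C_plus, <- (Rpower_C_0 (INR (S n))); f_equal; ring. }
    transitivity (Rpower_C (INR (S n)) (z - 1) * Rpower_C (INR (S n)) (1 - z)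
                  / Rpower_C (INR (S n)) (1 - z))%C; [rewrite E|]; field; auto.
Qed.

Lemma Gamma_neq_0 (z : C) : ~ nonpos_int z -> Gamma z <> RtoC 0.
Proof.
  intros Hz E; destruct (ex_lim_rG z) as [l Hl].
  assert (K := Clim_mult _ _ _ _ Hl (Gamma_lim z Hz)).
  rewrite E in K.
  assert (K1 : Clim (fun n => rG z n * / rG z n)%C (RtoC 1)).
  { apply Clim_ext with (u := fun _ => RtoC 1); [|apply Clim_const].
    intros n; field; apply rG_neq_0, Hz. }
  assert (X := Clim_unique _ _ _ K K1).
  replace (l * 0)%C with (RtoC 0) in X by ring; apply RtoC_inj in X; lra.
Qed.

Lemma rGamma_lim (z : C) : Clim (rG z) (rGamma z).
Proof.
  unfold rGamma; destruct excluded_middle_informative as [[m ->]|Hz].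
  - apply Clim_ext_loc with (u := fun _ => RtoC 0); [|apply Clim_const].
    exists m; intros n Hn; unfold rG; rewrite poch_nonpos_int by lia; unfold Cdiv; ring.
  - apply Clim_ext with (u := fun n => (/ / rG z n)%C).
    + intros n; field; apply rG_neq_0, Hz.
    + apply Clim_inv; [apply Gamma_neq_0, Hz | apply Gamma_lim, Hz].
Qed.

Lemma rGamma_eq (z : C) : ~ nonpos_int z -> rGamma z = (/ Gamma z)%C.
Proof.
  intros Hz; unfold rGamma; destruct excluded_middle_informative as [H|]; [contradiction|reflexivity].
Qed.

Lemma poch_S_rG (z : C) (n : nat) :
  poch z (S n) = (rG z n * RtoC (INR (fact (S n))) * Rpower_C (INR (S n)) (z - 1))%C.
Proof.
  unfold rG; pose proof (RtoC_fact_neq_0 (S n)).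
  transitivity (poch z (S n) * Rpower_C (INR (S n)) ((1 - z) + (z - 1)))%C.
  - replace ((1 - z) + (z - 1))%C with (RtoC 0) by ring; rewrite Rpower_C_0; ring.
  - rewrite Rpower_C_plus; field; auto.
Qed.

(** * Whipple's theorem *)

Definition whipple_term (al b : C) (c : R) (n : nat) : C :=
  (poch al n * poch (1 - al) n * poch c n
   / (poch 1 n * poch (c + 1 / 2 + b) n * poch (c + 1 / 2 - b) n))%C.

Lemma nonpos_int_pos (c : R) : 0 < c -> ~ nonpos_int (RtoC c).
Proof.
  intros Hc [n Hn]; rewrite <- RtoC_opp in Hn; apply RtoC_inj in Hn.
  pose proof (pos_INR n); lra.
Qed.

Lemma RtoC_S (n : nat) : RtoC (INR (S n)) = (RtoC (INR n) + 1)%C.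
Proof. rewrite S_INR, RtoC_plus; reflexivity. Qed.

Lemma RtoC_INR_double (n : nat) : RtoC (INR (2 * n)) = (2 * RtoC (INR n))%C.
Proof. rewrite mult_INR, RtoC_mult; reflexivity. Qed.

Lemma RtoC_neq_0 (x : R) : x <> 0 -> RtoC x <> RtoC 0.
Proof. intros H E; apply H, RtoC_inj, E. Qed.

Lemma Cmod_Rpower_C_RtoC (x y : R) : Cmod (Rpower_C x (RtoC y)) = Rpower x y.
Proof. rewrite Rpower_C_RtoC, Cmod_R; apply Rabs_pos_eq; left; apply exp_pos. Qed.

Lemma Rpower_le_three_halves (x c : R) :
  1 <= x -> 1 / 2 <= c -> Rpower x (- 1 - c) <= / (x * sqrt x).
Proof.
  intros Hx Hc.
  rewrite <- (Rpower_1 x) at 2 by lra.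
  rewrite <- Rpower_sqrt, <- Rpower_plus, <- Rpower_Ropp by lra.
  apply Rle_Rpower; lra.
Qed.

Section Whipple.

Variables (al b : C).

Lemma whipple_term_S (c : R) (n : nat) :
  0 < c -> ~ nonpos_int (c + 1 / 2 + b)%C -> ~ nonpos_int (c + 1 / 2 - b)%C ->
  whipple_term al b c (S n) = (whipple_term al b c n
    * ((al + RtoC (INR n)) * (1 - al + RtoC (INR n)) / RtoC (INR (S n)))
    * (RtoC (c + INR n) / (RtoC (c + INR n + / 2) * RtoC (c + INR n + / 2) - b * b)))%C.
Proof.
  intros Hc He Hf; unfold whipple_term; simpl poch.
  pose proof (poch_neq_0 1 n (nonpos_int_pos 1 Rlt_0_1)).
  pose proof (poch_neq_0 _ n He); pose proof (poch_neq_0 _ n Hf).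
  pose proof (nonpos_int_neq_0 _ n He) as Ne; pose proof (nonpos_int_neq_0 _ n Hf) as Nf.
  pose proof (RtoC_INR_neq_0 n) as N1; rewrite RtoC_S in *.
  rewrite !RtoC_plus, RtoC_inv by lra.
  set (x := RtoC (INR n)) in *; set (cc := RtoC c) in *.
  replace ((cc + x + / 2) * (cc + x + / 2) - b * b)%C
    with ((cc + 1 / 2 + b + x) * (cc + 1 / 2 - b + x))%C by (field; apply RtoC_neq_0; lra).
  set (E := (cc + 1 / 2 + b + x)%C) in *; set (F := (cc + 1 / 2 - b + x)%C) in *.
  field; repeat split; auto; rewrite Cplus_comm; auto.
Qed.

Lemma whipple_term_decay (c : R) :
  1 / 2 <= c -> ~ nonpos_int (c + 1 / 2 + b)%C -> ~ nonpos_int (c + 1 / 2 - b)%C ->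
  exists K, 0 <= K /\ forall n,
    Cmod (whipple_term al b c (S n)) <= K * / (INR (S n) * sqrt (INR (S n))).
Proof.
  intros Hc He Hf.
  assert (N1 := nonpos_int_pos 1 Rlt_0_1).
  destruct (Clim_bounded _ _ (Clim_mult _ _ _ _
     (Clim_mult _ _ _ _ (Clim_mult _ _ _ _ (rGamma_lim al) (rGamma_lim (1 - al))) (rGamma_lim c))
     (Clim_mult _ _ _ _ (Clim_mult _ _ _ _ (Gamma_lim _ N1) (Gamma_lim _ He)) (Gamma_lim _ Hf))))
    as [K [HK B]].
  exists K; split; [lra|]; intros n; specialize (B n); cbv beta in B.
  assert (Hx : 1 <= INR (S n)) by (rewrite S_INR; pose proof (pos_INR n); lra).
  replace (whipple_term al b c (S n)) with
    (rG al n * rG (1 - al) n * rG c n * (/ rG 1 n * / rG (c + 1 / 2 + b) n * / rG (c + 1 / 2 - b) n)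
     * Rpower_C (INR (S n)) (RtoC (- 1 - c)))%C.
  { rewrite Cmod_mult, Cmod_Rpower_C_RtoC.
    apply Rmult_le_compat; [apply Cmod_ge_0 | left; apply exp_pos | exact B |].
    apply Rpower_le_three_halves; assumption. }
  unfold whipple_term; rewrite !poch_S_rG.
  pose proof (rG_neq_0 _ n N1); pose proof (rG_neq_0 _ n He); pose proof (rG_neq_0 _ n Hf).
  pose proof (RtoC_fact_neq_0 (S n)).
  assert (HP := fun z => Rpower_C_neq_0 (INR (S n)) z).
  assert (E : (Rpower_C (INR (S n)) (al - 1) * Rpower_C (INR (S n)) (1 - al - 1)
      * Rpower_C (INR (S n)) (c - 1))%C
    = (Rpower_C (INR (S n)) (RtoC (- 1 - c)) * (Rpower_C (INR (S n)) (1 - 1)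
      * Rpower_C (INR (S n)) (c + 1 / 2 + b - 1) * Rpower_C (INR (S n)) (c + 1 / 2 - b - 1)))%C).
  { rewrite <- !Rpower_C_plus; f_equal; rewrite RtoC_minus; field. }
  assert (H4 := HP (1 - 1)%C); assert (H5 := HP (c + 1 / 2 + b - 1)%C);
    assert (H6 := HP (c + 1 / 2 - b - 1)%C).
  set (Z1 := Rpower_C (INR (S n)) (al - 1)) in *.
  set (Z2 := Rpower_C (INR (S n)) (1 - al - 1)) in *.
  set (Z3 := Rpower_C (INR (S n)) (c - 1)) in *.
  set (Z0 := Rpower_C (INR (S n)) (RtoC (- 1 - c))) in *.
  set (Z4 := Rpower_C (INR (S n)) (1 - 1)) in *.
  set (Z5 := Rpower_C (INR (S n)) (c + 1 / 2 + b - 1)) in *.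
  set (Z6 := Rpower_C (INR (S n)) (c + 1 / 2 - b - 1)) in *.
  replace Z0 with (Z1 * Z2 * Z3 / (Z4 * Z5 * Z6))%C by (rewrite E; field; auto).
  field; repeat split; auto.
Qed.

Lemma ex_series_Cmod_whipple_term (c : R) :
  1 / 2 <= c -> ~ nonpos_int (c + 1 / 2 + b)%C -> ~ nonpos_int (c + 1 / 2 - b)%C ->
  ex_series (fun n => Cmod (whipple_term al b c n)).
Proof.
  intros Hc He Hf; destruct (whipple_term_decay c Hc He Hf) as [K [HK B]].
  apply (ex_series_incr_1 (fun n => Cmod (whipple_term al b c n))).
  apply (ex_series_le (K := R_AbsRing) (V := R_CompleteNormedModule)
    _ (fun n => K * / (INR (S n) * sqrt (INR (S n))))).
  - intros n; change (Rabs (Cmod (whipple_term al b c (S n)))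
      <= K * / (INR (S n) * sqrt (INR (S n)))).
    rewrite Rabs_pos_eq by apply Cmod_ge_0; apply B.
  - destruct ex_series_three_halves as [s Hs]; exists (K * s); apply (is_series_scal_l K _ s Hs).
Qed.

Lemma ex_whipple_sum (c : R) :
  1 / 2 <= c -> ~ nonpos_int (c + 1 / 2 + b)%C -> ~ nonpos_int (c + 1 / 2 - b)%C ->
  exists s, Clim (Csum (whipple_term al b c)) s.
Proof.
  intros Hc He Hf.
  destruct (ex_series_le (K := C_AbsRing) (V := C_CompleteNormedModule)
    (whipple_term al b c) (fun n => Cmod (whipple_term al b c n))) as [s Hs].
  - intros n; right; reflexivity.
  - apply ex_series_Cmod_whipple_term; assumption.
  - exists s; apply is_series_Clim, Hs.
Qed.

Lemma poch_add_2 (z : C) (n : nat) :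
  (z * (z + 1) * poch (z + 2) n = poch z n * (z + RtoC (INR n)) * (z + RtoC (INR n) + 1))%C.
Proof.
  induction n as [|n IH]; simpl poch.
  - simpl; ring.
  - rewrite RtoC_S.
    replace (z * (z + 1) * (poch (z + 2) n * (z + 2 + RtoC (INR n))))%C
      with ((z * (z + 1) * poch (z + 2) n) * (z + 2 + RtoC (INR n)))%C by ring.
    rewrite IH; ring.
Qed.

Definition whipple_ratio (c : R) : C :=
  let e := (c + 1 / 2 + b)%C in let f := (c + 1 / 2 - b)%C in
  ((al + e) * (1 - al + e) * ((al + f) * (1 - al + f)) / (e * (e + 1) * (f * (f + 1))))%C.

(* Found by Gosper's algorithm applied to
   [whipple_term al b c n - whipple_ratio c * whipple_term al b (c + 2) n]. *)
Definition whipple_cert (c : R) (x : C) : C :=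
  let e := (c + 1 / 2 + b)%C in let f := (c + 1 / 2 - b)%C in
  let y := (- 1 - 4 * c + (e * f - al * (1 - al)) / (1 + c))%C in
  (x * (- x * x + y * x + (e * f - c + c * y)) / (c * (e + x) * (f + x)))%C.

Lemma whipple_telescope (c : R) (n : nat) :
  0 < c -> ~ nonpos_int (c + 1 / 2 + b)%C -> ~ nonpos_int (c + 1 / 2 - b)%C ->
  (Csum (whipple_term al b c) n - whipple_ratio c * Csum (whipple_term al b (c + 2)) n
   = whipple_cert c (RtoC (INR n)) * whipple_term al b c n)%C.
Proof.
  intros Hc He Hf.
  assert (N2 : RtoC 2 <> RtoC 0) by (apply RtoC_neq_0; lra).
  assert (Nc : RtoC c <> RtoC 0) by (apply RtoC_neq_0; lra).
  assert (Nc1 : (RtoC c + 1)%C <> RtoC 0) by (rewrite <- RtoC_plus; apply RtoC_neq_0; lra).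
  assert (Nc1' : (1 + RtoC c)%C <> RtoC 0) by (rewrite Cplus_comm; exact Nc1).
  assert (He2 : ~ nonpos_int (RtoC c + 1 / 2 + b + 2)%C) by (apply (nonpos_int_plus _ 2), He).
  assert (Hf2 : ~ nonpos_int (RtoC c + 1 / 2 - b + 2)%C) by (apply (nonpos_int_plus _ 2), Hf).
  induction n as [|n IH].
  - unfold whipple_cert; simpl; unfold Cdiv; ring.
  - simpl Csum.
    replace (Csum (whipple_term al b c) n + whipple_term al b c n
      - whipple_ratio c * (Csum (whipple_term al b (c + 2)) n + whipple_term al b (c + 2) n))%C
      with (whipple_cert c (RtoC (INR n)) * whipple_term al b c n + (whipple_term al b c n
      - whipple_ratio c * whipple_term al b (c + 2) n))%C by (rewrite <- IH; ring).
    rewrite whipple_term_S by assumption.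
    replace (RtoC (c + INR n + / 2)) with (RtoC c + RtoC (INR n) + 1 / 2)%C.
    2: { rewrite !RtoC_plus, RtoC_inv by lra; field; auto. }
    assert (E2 : whipple_term al b (c + 2) n = (whipple_term al b c n *
      let e := (c + 1 / 2 + b)%C in let f := (c + 1 / 2 - b)%C in let x := RtoC (INR n) in
      (c + x) * (c + x + 1) * (e * (e + 1) * (f * (f + 1)))
      / (c * (c + 1) * ((e + x) * (e + x + 1) * ((f + x) * (f + x + 1)))))%C).
    { unfold whipple_term; rewrite RtoC_plus.
      replace (c + 2 + 1 / 2 + b)%C with (c + 1 / 2 + b + 2)%C by ring.
      replace (c + 2 + 1 / 2 - b)%C with (c + 1 / 2 - b + 2)%C by ring.
      pose proof (poch_neq_0 1 n (nonpos_int_pos 1 Rlt_0_1)).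
      pose proof (poch_neq_0 _ n He) as P1; pose proof (poch_neq_0 _ n Hf) as P2.
      pose proof (poch_neq_0 _ n He2) as P3; pose proof (poch_neq_0 _ n Hf2) as P4.
      pose proof (nonpos_int_neq_0 _ n He) as E0; pose proof (nonpos_int_neq_0 _ n Hf) as F0.
      pose proof (nonpos_int_neq_0 _ (S n) He) as E1; pose proof (nonpos_int_neq_0 _ (S n) Hf) as F1.
      pose proof (nonpos_int_neq_0 _ 0 He) as E00; pose proof (nonpos_int_neq_0 _ 0 Hf) as F00.
      pose proof (nonpos_int_neq_0 _ 1 He) as E10; pose proof (nonpos_int_neq_0 _ 1 Hf) as F10.
      rewrite RtoC_S, Cplus_assoc in E1, F1; simpl in E00, F00, E10, F10.
      rewrite Cplus_0_r in E00, F00.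
      pose proof (poch_add_2 c n) as Q0.
      pose proof (poch_add_2 (c + 1 / 2 + b) n) as Q1; pose proof (poch_add_2 (c + 1 / 2 - b) n) as Q2.
      cbv zeta.
      set (e := (c + 1 / 2 + b)%C) in *; set (f := (c + 1 / 2 - b)%C) in *.
      set (x := RtoC (INR n)) in *.
      replace (poch (c + 2) n) with (poch c n * (c + x) * (c + x + 1) / (c * (c + 1)))%C
        by (rewrite <- Q0; field; auto).
      replace (poch (e + 2) n) with (poch e n * (e + x) * (e + x + 1) / (e * (e + 1)))%C
        by (rewrite <- Q1; field; auto).
      replace (poch (f + 2) n) with (poch f n * (f + x) * (f + x + 1) / (f * (f + 1)))%C
        by (rewrite <- Q2; field; auto).
      field; repeat split; auto. }
    rewrite E2; cbv zeta.
    assert (NS : (1 + RtoC (INR n))%C <> RtoC 0).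
    { rewrite Cplus_comm, <- RtoC_S; apply RtoC_INR_neq_0. }
    rewrite RtoC_plus, RtoC_S.
    pose proof (nonpos_int_neq_0 _ n He) as E0; pose proof (nonpos_int_neq_0 _ n Hf) as F0.
    pose proof (nonpos_int_neq_0 _ (S n) He) as E1; pose proof (nonpos_int_neq_0 _ (S n) Hf) as F1.
    pose proof (nonpos_int_neq_0 _ 0 He) as E00; pose proof (nonpos_int_neq_0 _ 0 Hf) as F00.
    pose proof (nonpos_int_neq_0 _ 1 He) as E10; pose proof (nonpos_int_neq_0 _ 1 Hf) as F10.
    rewrite RtoC_S, Cplus_assoc in E1, F1; simpl in E00, F00, E10, F10.
    rewrite Cplus_0_r in E00, F00.
    unfold whipple_cert, whipple_ratio; cbv zeta.
    set (x := RtoC (INR n)) in *.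
    replace ((c + x + 1 / 2) * (c + x + 1 / 2) - b * b)%C
      with ((c + 1 / 2 + b + x) * (c + 1 / 2 - b + x))%C by (field; auto).
    set (e := (c + 1 / 2 + b)%C) in *.
    assert (Ef : (c + 1 / 2 - b)%C = (1 + 2 * c - e)%C) by (unfold e; field; auto).
    rewrite Ef in *; clearbody e.
    set (w := whipple_term al b c n); clearbody w; clearbody x; clear IH E2.
    field; repeat split; auto; rewrite ?Cplus_assoc; auto; rewrite Cplus_comm; auto.
Qed.


Lemma whipple_cert_lim (c : R) :
  1 / 2 <= c -> ~ nonpos_int (c + 1 / 2 + b)%C -> ~ nonpos_int (c + 1 / 2 - b)%C ->
  Clim (fun n => whipple_cert c (RtoC (INR n)) * whipple_term al b c n)%C (RtoC 0).
Proof.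
  intros Hc He Hf.
  destruct (whipple_term_decay c Hc He Hf) as [K [HK B]].
  assert (Nc : RtoC c <> RtoC 0) by (apply RtoC_neq_0; lra).
  assert (Q : forall n, 0 < sqrt (INR (S n))) by (intros; apply sqrt_lt_R0, lt_0_INR; lia).
  assert (Lh : Clim (fun n => RtoC (/ INR (S n))) (RtoC 0)).
  { apply Clim_RtoC.
    apply (is_lim_seq_incr_1 (fun n => / INR n)).
    apply (is_lim_seq_inv _ p_infty); [apply is_lim_seq_INR | discriminate]. }
  assert (Lt : Clim (fun n => RtoC (INR (S n)) * whipple_term al b c (S n))%C (RtoC 0)).
  { apply Clim_le with (e := fun n => K * / sqrt (INR (S n))).
    - exists O; intros n _; unfold Cminus; rewrite Copp_0, Cplus_0_r, Cmod_mult, Cmod_R.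
      pose proof (lt_0_INR (S n) (Nat.lt_0_succ n)) as Hp; pose proof (Q n).
      rewrite Rabs_pos_eq by lra.
      apply Rle_trans with (INR (S n) * (K * / (INR (S n) * sqrt (INR (S n))))).
      + apply Rmult_le_compat_l; [lra | apply B].
      + right; field; split; apply Rgt_not_eq; assumption.
    - replace (Finite 0) with (Rbar_mult (Finite K) (Finite 0)) by (simpl; f_equal; ring).
      apply is_lim_seq_scal_l.
      apply (is_lim_seq_incr_1 (fun n => / sqrt (INR n))).
      apply (is_lim_seq_inv _ p_infty); [|discriminate].
      apply (filterlim_comp _ _ _ INR sqrt eventually (Rbar_locally p_infty)).
      + apply is_lim_seq_INR.
      + apply filterlim_sqrt_p. }
  apply Clim_incr_1.
  set (e := (c + 1 / 2 + b)%C) in *; set (f := (c + 1 / 2 - b)%C) in *.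
  set (y := (- 1 - 4 * c + (e * f - al * (1 - al)) / (1 + c))%C).
  set (y0 := (e * f - c + c * y)%C).
  apply Clim_ext with (u := fun n =>
    ((- (1) + y * RtoC (/ INR (S n)) + y0 * (RtoC (/ INR (S n)) * RtoC (/ INR (S n))))
     * / (c * ((1 + e * RtoC (/ INR (S n))) * (1 + f * RtoC (/ INR (S n)))))
     * (RtoC (INR (S n)) * whipple_term al b c (S n)))%C).
  - intros n; unfold whipple_cert; cbv zeta; fold e f y y0.
    pose proof (RtoC_INR_neq_0 n); rewrite RtoC_inv by (apply not_0_INR; lia).
    pose proof (nonpos_int_neq_0 _ (S n) He); pose proof (nonpos_int_neq_0 _ (S n) Hf).
    field; repeat split; auto; rewrite Cplus_comm; auto.
  - assert (L1 := fun z => Clim_mult _ _ _ _ (Clim_const z) Lh).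
    assert (L2 := Clim_mult _ _ _ _ Lh Lh).
    assert (Z : forall z : C, (1 + z * 0)%C = RtoC 1) by (intros; ring).
    assert (L3 := fun z => Clim_plus _ _ _ _ (Clim_const (RtoC 1)) (L1 z)).
    assert (L4 := Clim_mult _ _ _ _ (Clim_const (RtoC c)) (Clim_mult _ _ _ _ (L3 e) (L3 f))).
    apply Clim_inv in L4.
    2: { rewrite !Z, !Cmult_1_r; exact Nc. }
    assert (L5 := Clim_plus _ _ _ _ (Clim_plus _ _ _ _ (Clim_const (- (1))%C) (L1 y))
      (Clim_mult _ _ _ _ (Clim_const y0) L2)).
    assert (L6 := Clim_mult _ _ _ _ (Clim_mult _ _ _ _ L5 L4) Lt).
    cbv beta in L6; rewrite Cmult_0_r in L6; exact L6.
Qed.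

Lemma whipple_sum_shift (c : R) (s s' : C) :
  1 / 2 <= c -> ~ nonpos_int (c + 1 / 2 + b)%C -> ~ nonpos_int (c + 1 / 2 - b)%C ->
  Clim (Csum (whipple_term al b c)) s -> Clim (Csum (whipple_term al b (c + 2))) s' ->
  s = (whipple_ratio c * s')%C.
Proof.
  intros Hc He Hf Hs Hs'.
  assert (H := Clim_minus _ _ _ _ Hs (Clim_mult _ _ _ _ (Clim_const (whipple_ratio c)) Hs')).
  cbv beta in H.
  assert (E : (s - whipple_ratio c * s')%C = RtoC 0).
  { apply (Clim_unique _ _ _ H).
    apply Clim_ext with (2 := whipple_cert_lim c Hc He Hf).
    intros n; symmetry; apply whipple_telescope; auto; lra. }
  replace s with (s - whipple_ratio c * s' + whipple_ratio c * s')%C by ring.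
  rewrite E; ring.
Qed.

Lemma half_nonpos_int (z : C) : ~ nonpos_int z -> ~ nonpos_int (z / 2)%C /\ ~ nonpos_int ((z + 1) / 2)%C.
Proof.
  assert (N2 : RtoC 2 <> RtoC 0) by (apply RtoC_neq_0; lra).
  intros H; split; intros [n Hn]; apply H.
  - exists (2 * n)%nat; rewrite RtoC_INR_double.
    replace z with (2 * (z / 2))%C by (field; auto); rewrite Hn; ring.
  - exists (S (2 * n))%nat; rewrite RtoC_S, RtoC_INR_double.
    replace z with (2 * ((z + 1) / 2) - 1)%C by (field; auto); rewrite Hn; ring.
Qed.

Lemma whipple_shift_nonpos (c : R) (k : nat) :
  ~ nonpos_int (c + 1 / 2 + b)%C -> ~ nonpos_int (c + 1 / 2 - b)%C ->
  ~ nonpos_int (RtoC (c + 2 * INR k) + 1 / 2 + b)%C /\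
  ~ nonpos_int (RtoC (c + 2 * INR k) + 1 / 2 - b)%C.
Proof.
  intros He Hf.
  apply (nonpos_int_plus _ (2 * k)) in He; apply (nonpos_int_plus _ (2 * k)) in Hf.
  rewrite RtoC_INR_double in He, Hf.
  rewrite RtoC_plus, RtoC_mult; split.
  - replace (c + 2 * RtoC (INR k) + 1 / 2 + b)%C with (c + 1 / 2 + b + 2 * RtoC (INR k))%C by ring; exact He.
  - replace (c + 2 * RtoC (INR k) + 1 / 2 - b)%C with (c + 1 / 2 - b + 2 * RtoC (INR k))%C by ring; exact Hf.
Qed.

(* The quotient of Pochhammer symbols is the product of the first [k] ratios. *)
Lemma whipple_sum_iter (c : R) (s : nat -> C) (k : nat) :
  1 / 2 <= c -> ~ nonpos_int (c + 1 / 2 + b)%C -> ~ nonpos_int (c + 1 / 2 - b)%C ->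
  (forall j, Clim (Csum (whipple_term al b (c + 2 * INR j))) (s j)) ->
  let e := (c + 1 / 2 + b)%C in let f := (c + 1 / 2 - b)%C in
  s O = (poch ((al + e) / 2) k * poch ((1 - al + e) / 2) k
         * (poch ((al + f) / 2) k * poch ((1 - al + f) / 2) k)
         / (poch (e / 2) k * poch ((e + 1) / 2) k * (poch (f / 2) k * poch ((f + 1) / 2) k)) * s k)%C.
Proof.
  intros Hc He Hf Hs e f.
  assert (N2 : RtoC 2 <> RtoC 0) by (apply RtoC_neq_0; lra).
  destruct (half_nonpos_int _ He) as [He1 He2]; destruct (half_nonpos_int _ Hf) as [Hf1 Hf2].
  fold e in He1, He2; fold f in Hf1, Hf2.
  induction k as [|k IH].
  - simpl; field; apply RtoC_neq_0; lra.
  - rewrite IH.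
    destruct (whipple_shift_nonpos c k He Hf) as [Hek Hfk].
    assert (Hck : 1 / 2 <= c + 2 * INR k) by (pose proof (pos_INR k); lra).
    assert (HS : Clim (Csum (whipple_term al b (c + 2 * INR k + 2))) (s (S k))).
    { replace (c + 2 * INR k + 2) with (c + 2 * INR (S k)) by (rewrite S_INR; ring); apply Hs. }
    rewrite (whipple_sum_shift (c + 2 * INR k) (s k) (s (S k)) Hck Hek Hfk (Hs k) HS).
    simpl poch; unfold whipple_ratio; cbv zeta.
    rewrite RtoC_plus, RtoC_mult in Hek, Hfk |- *.
    pose proof (poch_neq_0 _ k He1); pose proof (poch_neq_0 _ k He2).
    pose proof (poch_neq_0 _ k Hf1); pose proof (poch_neq_0 _ k Hf2).
    pose proof (nonpos_int_neq_0 _ 0 Hek) as A0; pose proof (nonpos_int_neq_0 _ 0 Hfk) as B0.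
    pose proof (nonpos_int_neq_0 _ 1 Hek) as A1; pose proof (nonpos_int_neq_0 _ 1 Hfk) as B1.
    simpl in A0, B0, A1, B1; rewrite Cplus_0_r in A0, B0.
    replace (c + 2 * RtoC (INR k) + 1 / 2 + b)%C with (e + 2 * RtoC (INR k))%C in * by (unfold e; ring).
    replace (c + 2 * RtoC (INR k) + 1 / 2 - b)%C with (f + 2 * RtoC (INR k))%C in * by (unfold f; ring).
    set (x := RtoC (INR k)) in *; clearbody e f.
    field; repeat split; auto; intros E;
      [apply B1 | apply B0 | apply A1 | apply A0]; rewrite <- E; ring.
Qed.

End Whipple.

Lemma Cmod_Csum (a : nat -> C) (n : nat) : Cmod (Csum a (S n)) <= sum_n (fun k => Cmod (a k)) n.
Proof.
  induction n as [|n IH].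
  - rewrite sum_O; simpl; rewrite Cplus_0_l; lra.
  - rewrite sum_Sn_R.
    change (Csum a (S (S n))) with (Csum a (S n) + a (S n))%C.
    eapply Rle_trans; [apply Cmod_triangle | lra].
Qed.

Lemma Csum_S_first (a : nat -> C) (n : nat) : Csum a (S n) = (a O + Csum (fun k => a (S k)) n)%C.
Proof.
  induction n as [|n IH]; [simpl; ring|].
  change (Csum a (S (S n))) with (Csum a (S n) + a (S n))%C; rewrite IH; simpl; ring.
Qed.

Lemma sum_n_le_series (a : nat -> R) (s : R) (n : nat) :
  (forall k, 0 <= a k) -> is_series a s -> sum_n a n <= s.
Proof.
  intros Ha Hs; apply is_lim_seq_incr_compare with (1 := Hs).
  intros k; rewrite sum_Sn; unfold plus; simpl; specialize (Ha (S k)); lra.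
Qed.

Lemma sqr_sub_sqr_lower (x : R) (b : C) :
  0 <= x -> x * x - Cmod b * Cmod b <= Cmod (RtoC x * RtoC x - b * b)%C.
Proof.
  intros Hx.
  pose proof (Cmod_triangle (RtoC x * RtoC x - b * b) (b * b)) as T.
  replace (RtoC x * RtoC x - b * b + b * b)%C with (RtoC x * RtoC x)%C in T by ring.
  rewrite !Cmod_mult, !Cmod_R, Rabs_pos_eq in T by exact Hx. lra.
Qed.

Lemma factor_decreasing (beta x y : R) :
  1 / 2 <= x <= y -> 0 <= beta < x + / 2 ->
  y / ((y + / 2) * (y + / 2) - beta * beta) <= x / ((x + / 2) * (x + / 2) - beta * beta).
Proof.
  intros Hx Hb.
  assert (Dx : 0 < (x + / 2) * (x + / 2) - beta * beta) by nra.
  assert (Dy : 0 < (y + / 2) * (y + / 2) - beta * beta) by nra.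
  apply Rmult_le_reg_r with ((y + / 2) * (y + / 2) - beta * beta); [exact Dy|].
  apply Rmult_le_reg_r with ((x + / 2) * (x + / 2) - beta * beta); [exact Dx|].
  unfold Rdiv.
  replace (y * / ((y + / 2) * (y + / 2) - beta * beta) * ((y + / 2) * (y + / 2) - beta * beta)
    * ((x + / 2) * (x + / 2) - beta * beta)) with (y * ((x + / 2) * (x + / 2) - beta * beta))
    by (field; lra).
  replace (x * / ((x + / 2) * (x + / 2) - beta * beta) * ((y + / 2) * (y + / 2) - beta * beta)
    * ((x + / 2) * (x + / 2) - beta * beta)) with (x * ((y + / 2) * (y + / 2) - beta * beta))
    by (field; lra).
  assert (x * ((y + / 2) * (y + / 2) - beta * beta) - y * ((x + / 2) * (x + / 2) - beta * beta)
    = (y - x) * (x * y - / 4 + beta * beta)) by field.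
  assert (/ 4 <= x * y) by nra.
  assert (0 <= (y - x) * (x * y - / 4 + beta * beta)) by (apply Rmult_le_pos; nra).
  lra.
Qed.

Section WhippleLimit.

Variables (al b : C) (c0 : R).
Hypothesis Hc0 : 1 / 2 <= c0.
Hypothesis Hb : Cmod b * Cmod b + 1 <= c0.

Let beta := RtoC (Cmod b).

Lemma Cmod_b_lt : 0 <= Cmod b < c0 + / 2.
Proof. pose proof (Cmod_ge_0 b); split; [lra|]; nra. Qed.

Lemma nonpos_int_far (c : R) (z : C) : c0 <= c -> Cmod z <= Cmod b -> ~ nonpos_int (c + 1 / 2 + z)%C.
Proof.
  intros Hc Hz [n Hn].
  assert (E : z = RtoC (- (INR n + c + / 2))).
  { rewrite RtoC_opp, !RtoC_plus, RtoC_inv by lra.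
    replace z with (c + 1 / 2 + z - c - 1 / 2)%C by ring; rewrite Hn; field. }
  rewrite E, Cmod_R, Rabs_Ropp in Hz.
  pose proof Cmod_b_lt; pose proof (pos_INR n).
  rewrite Rabs_pos_eq in Hz by lra; lra.
Qed.

Lemma whipple_factor_le (c : R) (n : nat) : c0 <= c ->
  Cmod (RtoC (c + INR n) / (RtoC (c + INR n + / 2) * RtoC (c + INR n + / 2) - b * b))%C
  <= (c + INR n) / ((c + INR n + / 2) * (c + INR n + / 2) - Cmod b * Cmod b).
Proof.
  intros Hc; pose proof Cmod_b_lt; pose proof (pos_INR n).
  assert (D : 0 < (c + INR n + / 2) * (c + INR n + / 2) - Cmod b * Cmod b) by nra.
  assert (L := sqr_sub_sqr_lower (c + INR n + / 2) b ltac:(lra)).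
  rewrite Cmod_div.
  2: { apply Cmod_gt_0; lra. }
  rewrite Cmod_R, Rabs_pos_eq by lra.
  unfold Rdiv; apply Rmult_le_compat_l; [lra|].
  apply Rinv_le_contravar; lra.
Qed.

Lemma whipple_factor_beta (n : nat) :
  Cmod (RtoC (c0 + INR n) / (RtoC (c0 + INR n + / 2) * RtoC (c0 + INR n + / 2) - beta * beta))%C
  = (c0 + INR n) / ((c0 + INR n + / 2) * (c0 + INR n + / 2) - Cmod b * Cmod b).
Proof.
  pose proof Cmod_b_lt; pose proof (pos_INR n).
  assert (D : 0 < (c0 + INR n + / 2) * (c0 + INR n + / 2) - Cmod b * Cmod b) by nra.
  unfold beta; rewrite <- !RtoC_mult, <- RtoC_minus, <- RtoC_div by lra.
  rewrite Cmod_R; apply Rabs_pos_eq, Rdiv_le_0_compat; lra.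
Qed.

Let q0 := c0 / ((c0 + / 2) * (c0 + / 2) - Cmod b * Cmod b).

Lemma whipple_term_dominated (c : R) (n : nat) : c0 <= c ->
  Cmod (whipple_term al b c (S n)) <= / (c * q0) * Cmod (whipple_term al beta c0 (S n)).
Proof.
  intros Hc; pose proof Cmod_b_lt as Lb.
  assert (Fe := nonpos_int_far c b Hc (Rle_refl _)).
  assert (Ff : ~ nonpos_int (c + 1 / 2 - b)%C).
  { apply (nonpos_int_far c (- b) Hc); rewrite Cmod_opp; apply Rle_refl. }
  assert (Cb : Cmod beta = Cmod b).
  { unfold beta; rewrite Cmod_R; apply Rabs_pos_eq; lra. }
  assert (Ge : ~ nonpos_int (c0 + 1 / 2 + beta)%C).
  { apply nonpos_int_far; lra. }
  assert (Gf : ~ nonpos_int (c0 + 1 / 2 - beta)%C).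
  { apply (nonpos_int_far c0 (- beta)); [lra|]; rewrite Cmod_opp; lra. }
  assert (D0 : 0 < (c0 + / 2) * (c0 + / 2) - Cmod b * Cmod b) by nra.
  assert (Hq : 0 < q0) by (apply Rdiv_lt_0_compat; lra).
  induction n as [|n IH].
  - rewrite !whipple_term_S by (auto; lra).
    rewrite !Cmod_mult.
    assert (E : whipple_term al beta c0 0 = whipple_term al b c 0) by reflexivity.
    rewrite E, whipple_factor_beta.
    set (X := Cmod (whipple_term al b c 0) * _).
    assert (HX : 0 <= X) by (unfold X; rewrite <- Cmod_mult; apply Cmod_ge_0).
    simpl INR at 1 2 3 4; rewrite !Rplus_0_r.
    change (c0 / ((c0 + / 2) * (c0 + / 2) - Cmod b * Cmod b)) with q0.
    replace (/ (c * q0) * (X * q0)) with (X * / c) by (field; lra).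
    apply Rmult_le_compat_l; [exact HX|].
    pose proof (whipple_factor_le c 0 Hc) as L; simpl in L; rewrite Rplus_0_r in L.
    eapply Rle_trans; [exact L|].
    assert (D : 0 < (c + / 2) * (c + / 2) - Cmod b * Cmod b) by nra.
    apply Rmult_le_reg_r with ((c + / 2) * (c + / 2) - Cmod b * Cmod b); [exact D|].
    unfold Rdiv; rewrite Rmult_assoc, Rinv_l by lra.
    apply Rmult_le_reg_l with c; [lra|].
    rewrite <- (Rmult_assoc c (/ c)), Rinv_r by lra.
    nra.
  - rewrite (whipple_term_S al b c (S n)), (whipple_term_S al beta c0 (S n)) by (auto; lra).
    rewrite !(Cmod_mult (_ * _)), !(Cmod_mult (whipple_term _ _ _ _)), whipple_factor_beta.
    set (Y := Cmod ((al + _) * _ / _)).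
    assert (HY : 0 <= Y) by apply Cmod_ge_0.
    pose proof (pos_INR (S n)) as Pn.
    rewrite <- !Rmult_assoc.
    apply Rmult_le_compat.
    + apply Rmult_le_pos; [apply Cmod_ge_0 | exact HY].
    + apply Cmod_ge_0.
    + apply Rmult_le_compat_r; assumption.
    + eapply Rle_trans; [apply whipple_factor_le, Hc|].
      apply factor_decreasing; lra.
Qed.

Lemma whipple_sum_near_1 : exists T, forall (c : R) (s : C),
  c0 <= c -> Clim (Csum (whipple_term al b c)) s -> Cmod (s - 1)%C <= T * / c.
Proof.
  assert (Cb : Cmod beta = Cmod b).
  { unfold beta; rewrite Cmod_R; apply Rabs_pos_eq, Cmod_ge_0. }
  assert (Ge : ~ nonpos_int (c0 + 1 / 2 + beta)%C).
  { apply nonpos_int_far; lra. }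
  assert (Gf : ~ nonpos_int (c0 + 1 / 2 - beta)%C).
  { apply (nonpos_int_far c0 (- beta)); [lra|]; rewrite Cmod_opp; lra. }
  pose proof Cmod_b_lt as Lb.
  assert (D0 : 0 < (c0 + / 2) * (c0 + / 2) - Cmod b * Cmod b) by nra.
  assert (Hq : 0 < q0) by (apply Rdiv_lt_0_compat; lra).
  assert (HE := ex_series_Cmod_whipple_term al beta c0 Hc0 Ge Gf).
  apply (proj1 (ex_series_incr_1 _)) in HE; destruct HE as [T HT].
  exists (/ q0 * T); intros c s Hc Hs.
  apply (Clim_subseq _ _ (fun n => S (S n))) in Hs; [|lia].
  assert (L := Clim_Cmod _ _ (Clim_minus _ _ _ _ Hs (Clim_const (RtoC 1)))).
  assert (Hcq : 0 < c * q0) by (apply Rmult_lt_0_compat; lra).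
  replace (/ q0 * (T : R) * / c) with (/ (c * q0) * T) by (rewrite Rinv_mult; ring).
  change (Rbar_le (Finite (Cmod (s - 1)%C)) (Finite (/ (c * q0) * T))).
  apply (is_lim_seq_le _ (fun _ => / (c * q0) * T) _ _) with (2 := L) (3 := is_lim_seq_const _).
  intros n; rewrite Csum_S_first.
  replace (whipple_term al b c 0) with (RtoC 1).
  2: { unfold whipple_term; simpl; field; apply RtoC_neq_0; lra. }
  replace (1 + Csum (fun k => whipple_term al b c (S k)) (S n) - 1)%C
    with (Csum (fun k => whipple_term al b c (S k)) (S n)) by ring.
  eapply Rle_trans; [apply Cmod_Csum|].
  apply Rle_trans with (sum_n (fun k => / (c * q0) * Cmod (whipple_term al beta c0 (S k))) n).
  - apply sum_n_m_le; intros k; apply whipple_term_dominated, Hc.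
  - rewrite (sum_n_mult_l (K := R_AbsRing) (/ (c * q0))).
    change (/ (c * q0) * sum_n (fun k => Cmod (whipple_term al beta c0 (S k))) n <= / (c * q0) * T).
    apply Rmult_le_compat_l; [left; apply Rinv_0_lt_compat, Hcq|].
    apply sum_n_le_series with (2 := HT); intros; apply Cmod_ge_0.
Qed.

End WhippleLimit.

Theorem whipple (al b : C) (c : R) :
  1 / 2 <= c -> ~ nonpos_int (c + 1 / 2 + b)%C -> ~ nonpos_int (c + 1 / 2 - b)%C ->
  let e := (c + 1 / 2 + b)%C in let f := (c + 1 / 2 - b)%C in
  Clim (Csum (whipple_term al b c))
    (Gamma (e / 2) * Gamma ((e + 1) / 2) * (Gamma (f / 2) * Gamma ((f + 1) / 2))
     * (rGamma ((al + e) / 2) * rGamma ((1 - al + e) / 2)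
        * (rGamma ((al + f) / 2) * rGamma ((1 - al + f) / 2))))%C.
Proof.
  intros Hc He Hf e f.
  assert (Hck : forall j, 1 / 2 <= c + 2 * INR j) by (intros j; pose proof (pos_INR j); lra).
  assert (HS : forall j, exists s, Clim (Csum (whipple_term al b (c + 2 * INR j))) s).
  { intros j; destruct (whipple_shift_nonpos b c j He Hf); apply ex_whipple_sum; auto. }
  set (s := fun j => proj1_sig (constructive_indefinite_description _ (HS j))).
  assert (Hs : forall j, Clim (Csum (whipple_term al b (c + 2 * INR j))) (s j)).
  { intros j; unfold s; apply proj2_sig. }
  assert (H0 := Hs O); simpl in H0; rewrite Rmult_0_r, Rplus_0_r in H0.
  match goal with |- Clim _ ?l => replace l with (s O) end; [exact H0|].
  assert (L1 : Clim s (RtoC 1)).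
  { set (c0 := Rmax (1 / 2) (Cmod b * Cmod b + 1)).
    destruct (whipple_sum_near_1 al b c0 (Rmax_l _ _) (Rmax_r _ _)) as [T HT].
    assert (LI : is_lim_seq (fun j => c + 2 * INR j) p_infty).
    { apply is_lim_seq_le_p_loc with (u := INR); [|apply is_lim_seq_INR].
      exists O; intros n _; pose proof (pos_INR n); lra. }
    apply Clim_le with (e := fun j => T * / (c + 2 * INR j)).
    - assert (EV := LI (fun x => c0 < x) (ex_intro _ c0 (fun x h => h))).
      destruct EV as [N HN]; exists N; intros j Hj; specialize (HN j Hj); cbv beta in HN.
      apply HT; [left; exact HN | apply Hs].
    - replace (Finite 0) with (Rbar_mult (Finite T) (Finite 0)) by (simpl; f_equal; ring).
      apply is_lim_seq_scal_l; apply (is_lim_seq_inv _ p_infty); [exact LI | discriminate]. }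
  destruct (half_nonpos_int _ He) as [He1 He2]; destruct (half_nonpos_int _ Hf) as [Hf1 Hf2].
  fold e in He1, He2; fold f in Hf1, Hf2.
  apply Clim_unique with (u := fun _ => s O); [apply Clim_const|].
  apply (Clim_subseq _ _ S) in L1; [|lia].
  assert (L := Clim_mult _ _ _ _
    (Clim_mult _ _ _ _
      (Clim_mult _ _ _ _ (Clim_mult _ _ _ _ (Gamma_lim _ He1) (Gamma_lim _ He2))
        (Clim_mult _ _ _ _ (Gamma_lim _ Hf1) (Gamma_lim _ Hf2)))
      (Clim_mult _ _ _ _
        (Clim_mult _ _ _ _ (rGamma_lim ((al + e) / 2)) (rGamma_lim ((1 - al + e) / 2)))
        (Clim_mult _ _ _ _ (rGamma_lim ((al + f) / 2)) (rGamma_lim ((1 - al + f) / 2)))))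
    L1).
  rewrite Cmult_1_r in L.
  apply Clim_ext with (2 := L); intros n.
  rewrite (whipple_sum_iter al b c s (S n) Hc He Hf Hs); fold e f.
  rewrite !poch_S_rG.
  assert (N2 : RtoC 2 <> RtoC 0) by (apply RtoC_neq_0; lra).
  pose proof (rG_neq_0 _ n He1); pose proof (rG_neq_0 _ n He2).
  pose proof (rG_neq_0 _ n Hf1); pose proof (rG_neq_0 _ n Hf2).
  pose proof (RtoC_fact_neq_0 (S n)).
  set (x := INR (S n)).
  assert (HP := fun z => Rpower_C_neq_0 x z).
  assert (E : (Rpower_C x ((al + e) / 2 - 1) * Rpower_C x ((1 - al + e) / 2 - 1)
      * (Rpower_C x ((al + f) / 2 - 1) * Rpower_C x ((1 - al + f) / 2 - 1)))%C
    = (Rpower_C x (e / 2 - 1) * Rpower_C x ((e + 1) / 2 - 1)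
      * (Rpower_C x (f / 2 - 1) * Rpower_C x ((f + 1) / 2 - 1)))%C).
  { rewrite <- !Rpower_C_plus; f_equal; field; auto. }
  pose proof (HP (e / 2 - 1)%C) as H5; pose proof (HP ((e + 1) / 2 - 1)%C) as H6.
  pose proof (HP (f / 2 - 1)%C) as H7; pose proof (HP ((f + 1) / 2 - 1)%C) as H8.
  pose proof (HP ((al + e) / 2 - 1)%C) as G5; pose proof (HP ((1 - al + e) / 2 - 1)%C) as G6.
  pose proof (HP ((al + f) / 2 - 1)%C) as G7; pose proof (HP ((1 - al + f) / 2 - 1)%C) as G8.
  set (Z1 := Rpower_C x ((al + e) / 2 - 1)) in *.
  set (Z2 := Rpower_C x ((1 - al + e) / 2 - 1)) in *.
  set (Z3 := Rpower_C x ((al + f) / 2 - 1)) in *.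
  set (Z4 := Rpower_C x ((1 - al + f) / 2 - 1)) in *.
  set (Z5 := Rpower_C x (e / 2 - 1)) in *.
  set (Z6 := Rpower_C x ((e + 1) / 2 - 1)) in *.
  set (Z7 := Rpower_C x (f / 2 - 1)) in *.
  set (Z8 := Rpower_C x ((f + 1) / 2 - 1)) in *.
  replace Z1 with (Z5 * Z6 * (Z7 * Z8) / (Z2 * (Z3 * Z4)))%C by (rewrite <- E; field; auto).
  field; repeat split; auto.
Qed.

(** * Pfaff-Saalschuetz, Vandermonde and the exchange of sums *)

Lemma Csum_ext (a a' : nat -> C) (n : nat) :
  (forall k, (k < n)%nat -> a k = a' k) -> Csum a n = Csum a' n.
Proof.
  induction n as [|n IH]; intros H; simpl; [reflexivity|].
  rewrite IH, H by (intros; try apply H; lia); reflexivity.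
Qed.

Lemma Csum_scal (z : C) (a : nat -> C) (n : nat) : Csum (fun k => z * a k)%C n = (z * Csum a n)%C.
Proof. induction n as [|n IH]; simpl; [|rewrite IH]; ring. Qed.

Lemma Csum_plus (a a' : nat -> C) (n : nat) :
  Csum (fun k => a k + a' k)%C n = (Csum a n + Csum a' n)%C.
Proof. induction n as [|n IH]; simpl; [|rewrite IH]; ring. Qed.

Lemma Csum_0 (a : nat -> C) (n : nat) :
  (forall k, (k < n)%nat -> a k = RtoC 0) -> Csum a n = RtoC 0.
Proof.
  induction n as [|n IH]; intros H; simpl; [reflexivity|].
  rewrite IH, H by (intros; try apply H; lia); ring.
Qed.

Lemma Csum_exchange (f : nat -> nat -> C) (m n : nat) :
  Csum (fun i => Csum (f i) n) m = Csum (fun j => Csum (fun i => f i j) m) n.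
Proof.
  induction m as [|m IH]; simpl.
  - symmetry; apply Csum_0; reflexivity.
  - rewrite IH, Csum_plus; reflexivity.
Qed.

Lemma Csum_add (a : nat -> C) (m n : nat) :
  Csum a (m + n) = (Csum a m + Csum (fun k => a (m + k)%nat) n)%C.
Proof.
  induction n as [|n IH]; simpl; [rewrite Nat.add_0_r; ring|].
  rewrite Nat.add_succ_r; simpl; rewrite IH; ring.
Qed.

Lemma poch_S_left (z : C) (n : nat) : poch z (S n) = (z * poch (z + 1) n)%C.
Proof.
  induction n as [|n IH]; [simpl; ring|].
  change (poch z (S (S n))) with (poch z (S n) * (z + RtoC (INR (S n))))%C.
  rewrite IH, RtoC_S; simpl; ring.
Qed.

Lemma poch_add (z : C) (m n : nat) :
  poch z (m + n) = (poch z m * poch (z + RtoC (INR m)) n)%C.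
Proof.
  induction n as [|n IH]; [rewrite Nat.add_0_r; simpl; ring|].
  rewrite Nat.add_succ_r; simpl; rewrite IH, plus_INR, RtoC_plus; ring.
Qed.

Lemma poch_opp (z : C) (n : nat) :
  poch (- z) n = ((- (1)) ^ n * poch (z - RtoC (INR n) + 1) n)%C.
Proof.
  induction n as [|n IH]; [simpl; ring|].
  rewrite (poch_S_left (z - RtoC (INR (S n)) + 1)), RtoC_S.
  replace (z - (RtoC (INR n) + 1) + 1 + 1)%C with (z - RtoC (INR n) + 1)%C by ring.
  simpl; rewrite IH; ring.
Qed.

Lemma poch_double (z : C) (n : nat) :
  poch z (2 * n) = (RtoC 4 ^ n * (poch (z / 2) n * poch ((z + 1) / 2) n))%C.
Proof.
  assert (N2 : RtoC 2 <> RtoC 0) by (apply RtoC_neq_0; lra).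
  induction n as [|n IH]; [simpl; ring|].
  replace (2 * S n)%nat with (S (S (2 * n))) by lia.
  change (poch z (S (S (2 * n))))
    with (poch z (2 * n) * (z + RtoC (INR (2 * n))) * (z + RtoC (INR (S (2 * n)))))%C.
  rewrite IH, RtoC_S, RtoC_INR_double; simpl; field; auto.
Qed.

Lemma poch_opp_fact (r m : nat) :
  (poch (- RtoC (INR (r + m))) r * poch 1 m = (- (1)) ^ r * poch 1 (r + m))%C.
Proof.
  rewrite poch_opp, (Nat.add_comm r m), (poch_add _ m r), plus_INR, RtoC_plus.
  replace (INR m + INR r - INR r + 1)%C with (1 + INR m)%C by ring; ring.
Qed.

Lemma vandermonde (K : nat) : forall (x y : C) (L : nat),
  ~ nonpos_int y -> (K < L)%nat ->
  Csum (fun m => poch (- RtoC (INR K)) m * poch x m / (poch 1 m * poch y m))%C L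
  = (poch (y - x) K / poch y K)%C.
Proof.
  induction K as [|K IH]; intros x y [|L] Hy HL; try lia.
  - rewrite Csum_S_first, Csum_0.
    + simpl; field; apply RtoC_neq_0; lra.
    + intros k _; rewrite poch_S_left; simpl INR.
      unfold Cdiv; rewrite Copp_0; ring.
  - assert (Hy1 : ~ nonpos_int (y + 1)%C) by apply (nonpos_int_plus y 1 Hy).
    assert (Y0 : y <> RtoC 0).
    { pose proof (nonpos_int_neq_0 y 0 Hy) as H; simpl in H; rewrite Cplus_0_r in H; exact H. }
    rewrite Csum_S_first.
    rewrite (Csum_ext _ (fun m =>
      (poch (- RtoC (INR K)) (S m) * poch x (S m) / (poch 1 (S m) * poch y (S m)))
      + (- (x / y)) * (poch (- RtoC (INR K)) m * poch (x + 1) m / (poch 1 m * poch (y + 1) m)))%C).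
    + rewrite Csum_plus, Csum_scal, (IH (x + 1)%C (y + 1)%C) by (auto; lia).
      assert (I := IH x y (S L) Hy ltac:(lia)).
      rewrite Csum_S_first in I; simpl poch at 1 2 3 4 in I.
      rewrite Cplus_assoc; simpl poch at 1 2 3 4; rewrite I.
      replace (y + 1 - (x + 1))%C with (y - x)%C by ring.
      assert (E := poch_S_left y K); simpl in E.
      pose proof (poch_neq_0 _ K Hy1); pose proof (poch_neq_0 _ K Hy).
      pose proof (nonpos_int_neq_0 _ K Hy).
      simpl.
      replace (poch y K) with (y * poch (y + 1) K / (y + RtoC (INR K)))%C
        by (rewrite <- E; field; auto).
      field; auto.
    + intros m _.
      pose proof (poch_neq_0 1 m (nonpos_int_pos 1 Rlt_0_1)).
      pose proof (poch_neq_0 _ m Hy1).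
      pose proof (nonpos_int_neq_0 1 m (nonpos_int_pos 1 Rlt_0_1)).
      rewrite (poch_S_left x), (poch_S_left y), (poch_S_left (- RtoC (INR (S K)))).
      replace (- RtoC (INR (S K)) + 1)%C with (- RtoC (INR K))%C by (rewrite RtoC_S; ring).
      change (poch (- RtoC (INR K)) (S m))
        with (poch (- RtoC (INR K)) m * (- RtoC (INR K) + RtoC (INR m)))%C.
      change (poch 1 (S m)) with (poch 1 m * (1 + RtoC (INR m)))%C.
      rewrite RtoC_S; field; auto.
Qed.

Section Saalschutz.

Variables A B D : C.
Let E := (1 + A - B - D)%C.
Let F := (1 + A - B)%C.
Let G := (1 + A - D)%C.
Hypothesis HF : ~ nonpos_int F.
Hypothesis HG : ~ nonpos_int G.

Let q (r : nat) : C := (poch E r / (poch 1 r * poch F r * poch G r))%C.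
Let saal (n r : nat) : C := (poch (- RtoC (INR n)) r * poch (A + RtoC (INR n)) r * q r)%C.

Lemma saalschutz_telescope (n L : nat) :
  ((F + RtoC (INR n)) * (G + RtoC (INR n)) * Csum (saal (S n)) (S L)
   - (B + RtoC (INR n)) * (D + RtoC (INR n)) * Csum (saal n) (S L)
   = (2 * RtoC (INR n) + 1 + A) * poch (- RtoC (INR n)) L * poch (A + RtoC (INR n) + 1) L
     * (E + RtoC (INR L)) * q L)%C.
Proof.
  induction L as [|L IH].
  - unfold saal, q; simpl; unfold E, F, G; field; apply RtoC_neq_0; lra.
  - set (X := Csum (saal (S n)) (S L)) in *; set (Y := Csum (saal n) (S L)) in *.
    change (Csum (saal (S n)) (S (S L))) with (X + saal (S n) (S L))%C.
    change (Csum (saal n) (S (S L))) with (Y + saal n (S L))%C.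
    transitivity (((F + RtoC (INR n)) * (G + RtoC (INR n)) * X
      - (B + RtoC (INR n)) * (D + RtoC (INR n)) * Y)
      + ((F + RtoC (INR n)) * (G + RtoC (INR n)) * saal (S n) (S L)
      - (B + RtoC (INR n)) * (D + RtoC (INR n)) * saal n (S L)))%C; [ring|].
    rewrite IH; unfold saal, q.
    rewrite (poch_S_left (- RtoC (INR (S n)))), (poch_S_left (A + RtoC (INR n))).
    replace (- RtoC (INR (S n)) + 1)%C with (- RtoC (INR n))%C by (rewrite RtoC_S; ring).
    replace (A + RtoC (INR (S n)))%C with (A + RtoC (INR n) + 1)%C by (rewrite RtoC_S; ring).
    pose proof (poch_neq_0 1 L (nonpos_int_pos 1 Rlt_0_1)).
    pose proof (poch_neq_0 _ L HF); pose proof (poch_neq_0 _ L HG).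
    pose proof (nonpos_int_neq_0 1 L (nonpos_int_pos 1 Rlt_0_1)).
    pose proof (nonpos_int_neq_0 _ L HF) as F0; pose proof (nonpos_int_neq_0 _ L HG) as G0.
    simpl poch; rewrite !RtoC_S.
    generalize dependent (poch F L); generalize dependent (poch G L).
    intros pG ? pF ?; unfold E, F, G in *.
    field; repeat split; auto.
Qed.

Lemma saalschutz (n : nat) : forall L, (n < L)%nat ->
  Csum (saal n) L = (poch B n * poch D n / (poch F n * poch G n))%C.
Proof.
  induction n as [|n IH]; intros [|L] HL; try lia.
  - rewrite Csum_S_first, Csum_0.
    + unfold saal, q; simpl; field; apply RtoC_neq_0; lra.
    + intros k _; unfold saal; rewrite poch_S_left; simpl INR; rewrite Copp_0; ring.
  - assert (T := saalschutz_telescope n L).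
    rewrite poch_nonpos_int, (IH (S L)) in T by lia.
    pose proof (poch_neq_0 _ n HF); pose proof (poch_neq_0 _ n HG).
    pose proof (nonpos_int_neq_0 _ n HF) as F0; pose proof (nonpos_int_neq_0 _ n HG) as G0.
    simpl poch.
    set (X := Csum (saal (S n)) (S L)) in *.
    assert (T' : ((F + RtoC (INR n)) * (G + RtoC (INR n)) * X)%C
      = ((B + RtoC (INR n)) * (D + RtoC (INR n)) * (poch B n * poch D n / (poch F n * poch G n)))%C).
    { match type of T with (?u - ?v = _)%C => transitivity (u - v + v)%C; [ring | rewrite T; ring] end. }
    transitivity ((F + RtoC (INR n)) * (G + RtoC (INR n)) * X
      / ((F + RtoC (INR n)) * (G + RtoC (INR n))))%C; [field; auto|].
    rewrite T'; field; auto.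
Qed.

(* Insert [saalschutz] in the left side, exchange the sums and evaluate the
   inner one by [vandermonde]. *)
Lemma bailey (N : nat) (c : C) : ~ nonpos_int c ->
  Csum (fun n => poch A n * poch B n * poch D n / (poch 1 n * poch F n * poch G n)
                 * (poch (- RtoC (INR N)) n / poch c n))%C (S N)
  = Csum (fun r => q r * poch A (2 * r)
       * ((- (1)) ^ r * poch (- RtoC (INR N)) r * poch (c - A - RtoC (INR r)) (N - r) / poch c N))%C (S N).
Proof.
  intros Hc.
  assert (H1 := nonpos_int_pos 1 Rlt_0_1).
  rewrite (Csum_ext _ (fun n => Csum (fun r =>
    (poch A n / poch 1 n * (poch (- RtoC (INR N)) n / poch c n)) * saal n r)%C (S N))).
  2: { intros n Hn; rewrite Csum_scal, (saalschutz n) by lia.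
       pose proof (poch_neq_0 _ n HF); pose proof (poch_neq_0 _ n HG).
       pose proof (poch_neq_0 _ n H1); pose proof (poch_neq_0 _ n Hc).
       field; auto. }
  rewrite Csum_exchange; apply Csum_ext; intros r Hr.
  replace (S N) with (r + S (N - r))%nat by lia.
  rewrite Csum_add, Csum_0, Cplus_0_l.
  2: { intros n Hn; unfold saal; rewrite (poch_nonpos_int n r Hn); ring. }
  assert (Hcr := nonpos_int_plus _ r Hc).
  assert (V := vandermonde (N - r) (A + RtoC (INR (2 * r))) (c + RtoC (INR r)) (S (N - r)) Hcr
    ltac:(lia)).
  rewrite (Csum_ext _ (fun m => (q r * poch A (2 * r) * ((- (1)) ^ r * poch (- RtoC (INR N)) r / poch c r))
    * (poch (- RtoC (INR (N - r))) m * poch (A + RtoC (INR (2 * r))) m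
       / (poch 1 m * poch (c + RtoC (INR r)) m)))%C).
  - rewrite Csum_scal, V.
    replace (c + RtoC (INR r) - (A + RtoC (INR (2 * r))))%C with (c - A - RtoC (INR r))%C
      by (rewrite RtoC_INR_double; ring).
    replace (poch c N) with (poch c r * poch (c + RtoC (INR r)) (N - r))%C.
    2: { rewrite <- poch_add; f_equal; lia. }
    pose proof (poch_neq_0 _ r Hc); pose proof (poch_neq_0 _ (N - r) Hcr).
    field; auto.
  - intros m Hm; unfold saal.
    pose proof (poch_neq_0 _ r Hc); pose proof (poch_neq_0 _ m Hcr).
    pose proof (poch_neq_0 _ m H1); pose proof (poch_neq_0 _ (r + m) H1).
    replace (poch (- RtoC (INR (r + m))) r)
      with ((- (1)) ^ r * poch 1 (r + m) / poch 1 m)%C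
      by (rewrite <- poch_opp_fact; field; auto).
    rewrite (poch_add c), (poch_add (- RtoC (INR N))).
    replace (- RtoC (INR N) + RtoC (INR r))%C with (- RtoC (INR (N - r)))%C.
    2: { rewrite minus_INR, RtoC_minus by lia; ring. }
    assert (EA : (poch A (2 * r) * poch (A + RtoC (INR (2 * r))) m
      = poch A (r + m) * poch (A + RtoC (INR (r + m))) r)%C).
    { rewrite <- !poch_add; f_equal; lia. }
    transitivity (poch A (r + m) * poch (A + RtoC (INR (r + m))) r
      * ((- (1)) ^ r * poch (- RtoC (INR N)) r * poch (- RtoC (INR (N - r))) m * q r
      / (poch 1 m * (poch c r * poch (c + RtoC (INR r)) m))))%C; [field; auto|].
    rewrite <- EA; field; auto.
Qed.

End Saalschutz.

(** * Passage to the limit *)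

Lemma sum_n_split (a : nat -> R) (n m : nat) :
  (n <= m)%nat -> sum_n a m = sum_n a n + sum_n_m a (S n) m.
Proof. intros H; unfold sum_n; rewrite (sum_n_m_Chasles a 0 n m) by lia; reflexivity. Qed.

Lemma sum_n_le_R (a a' : nat -> R) (n m : nat) :
  (forall k, a k <= a' k) -> sum_n_m a n m <= sum_n_m a' n m.
Proof. apply sum_n_m_le. Qed.

Lemma tannery (a : nat -> C) (w : nat -> nat -> R) (l : nat -> R) (N : nat -> nat) (s : C) :
  ex_series (fun n => Cmod (a n)) ->
  (forall m n, Rabs (w m n) <= 1) -> (forall n, Rabs (l n) <= 1) ->
  (forall n, is_lim_seq (fun m => w m n) (l n)) -> (forall m, (m <= N m)%nat) ->
  Clim (Csum (fun n => a n * RtoC (l n))%C) s ->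
  Clim (fun m => Csum (fun n => a n * RtoC (w m n))%C (S (N m))) s.
Proof.
  intros [T HT] Hw Hl Hlim HN Hs.
  assert (Ha : forall n, 0 <= Cmod (a n)) by (intros; apply Cmod_ge_0).
  set (d := fun m n => Cmod (a n) * Rabs (w m n - l n)).
  set (D := fun m => sum_n (d m) (N m)).
  assert (HD : is_lim_seq D 0).
  { assert (Dpos : forall m, 0 <= D m).
    { intros m; unfold D; induction (N m) as [|n IH].
      - rewrite sum_O; apply Rmult_le_pos; [apply Ha | apply Rabs_pos].
      - rewrite sum_Sn_R.
        apply Rplus_le_le_0_compat; [exact IH|].
        apply Rmult_le_pos; [apply Ha | apply Rabs_pos]. }
    assert (Dbound : forall n m, (n <= m)%nat ->
      D m <= sum_n (d m) n + 2 * (T - sum_n (fun k => Cmod (a k)) n)).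
    { intros n m Hnm; specialize (HN m); unfold D.
      rewrite (sum_n_split (d m) n) by lia; apply Rplus_le_compat_l.
      apply Rle_trans with (sum_n_m (fun k => 2 * Cmod (a k)) (S n) (N m)).
      - apply sum_n_le_R; intros k; unfold d; rewrite (Rmult_comm 2).
        apply Rmult_le_compat_l; [apply Ha|].
        unfold Rminus; eapply Rle_trans; [apply Rabs_triang|]; rewrite Rabs_Ropp.
        specialize (Hw m k); specialize (Hl k); lra.
      - rewrite (sum_n_m_mult_l (K := R_AbsRing) 2).
        change (2 * sum_n_m (fun k => Cmod (a k)) (S n) (N m)
          <= 2 * (T - sum_n (fun k => Cmod (a k)) n)).
        assert (P := sum_n_le_series _ T (N m) Ha HT).
        rewrite (sum_n_split _ n) in P by lia; lra. }
    assert (Lfin : forall n, is_lim_seq (fun m => sum_n (d m) n) 0).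
    { assert (L1 : forall n, is_lim_seq (fun m => d m n) 0).
      { intros n; unfold d.
        replace (Finite 0) with (Rbar_mult (Finite (Cmod (a n))) (Finite 0))
          by (simpl; f_equal; ring).
        apply is_lim_seq_scal_l, (proj1 (is_lim_seq_abs_0 _)).
        replace (Finite 0) with (Finite (l n - l n)) by (f_equal; ring).
        apply is_lim_seq_minus'; [apply Hlim | apply is_lim_seq_const]. }
      induction n as [|n IH].
      - apply is_lim_seq_ext with (2 := L1 O); intros m; rewrite sum_O; reflexivity.
      - apply is_lim_seq_ext with (u := fun m => sum_n (d m) n + d m (S n)).
        + intros m; rewrite sum_Sn_R; reflexivity.
        + replace (Finite 0) with (Finite (0 + 0)) by (f_equal; ring).
          apply is_lim_seq_plus'; [exact IH | apply L1]. }
    apply is_lim_seq_Reals; intros eps Heps.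
    assert (HT' : is_lim_seq (sum_n (fun k => Cmod (a k))) T) by exact HT.
    apply is_lim_seq_Reals in HT'.
    destruct (HT' (eps / 4)) as [n Hn]; [lra|].
    specialize (Hn n (Nat.le_refl n)); unfold Rdist in Hn.
    apply Rabs_def2 in Hn.
    specialize (Lfin n); apply is_lim_seq_Reals in Lfin.
    destruct (Lfin (eps / 4)) as [m0 Hm0]; [lra|].
    exists (max n m0); intros m Hm.
    specialize (Hm0 m ltac:(lia)); unfold Rdist in Hm0 |- *.
    rewrite Rminus_0_r in Hm0 |- *; apply Rabs_def2 in Hm0.
    rewrite Rabs_pos_eq by apply Dpos.
    specialize (Dbound n m ltac:(lia)); lra. }
  assert (L := Clim_subseq _ _ (fun m => S (N m)) ltac:(intros m; specialize (HN m); simpl; lia) Hs).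
  assert (L0 : Clim (fun m => Csum (fun n => a n * RtoC (w m n))%C (S (N m))
      - Csum (fun n => a n * RtoC (l n))%C (S (N m)))%C (RtoC 0)).
  { apply Clim_le with (e := D); [|exact HD].
    exists O; intros m _; unfold Cminus at 1; rewrite Copp_0, Cplus_0_r.
    replace (Csum _ _ - Csum _ _)%C
      with (Csum (fun n => a n * RtoC (w m n - l n))%C (S (N m))).
    - eapply Rle_trans; [apply Cmod_Csum|].
      unfold D; apply sum_n_le_R; intros k; rewrite Cmod_mult, Cmod_R; right; reflexivity.
    - transitivity (Csum (fun n => a n * RtoC (w m n) + (- (1)) * (a n * RtoC (l n)))%C (S (N m))).
      + apply Csum_ext; intros k _; rewrite RtoC_minus; ring.
      + rewrite Csum_plus, Csum_scal; ring. }
  assert (L2 := Clim_plus _ _ _ _ L0 L); rewrite Cplus_0_l in L2.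
  apply Clim_ext with (2 := L2); intros m; cbv beta; ring.
Qed.

Fixpoint rprod (f : nat -> R) (n : nat) : R :=
  match n with
  | O => 1
  | S m => rprod f m * f m
  end.

Lemma rprod_lim (f : nat -> nat -> R) (l : R) (n : nat) :
  (forall j, is_lim_seq (fun m => f m j) l) -> is_lim_seq (fun m => rprod (f m) n) (l ^ n).
Proof.
  intros H; induction n as [|n IH]; simpl; [apply is_lim_seq_const|].
  rewrite Rmult_comm; apply is_lim_seq_mult'; auto.
Qed.

Lemma Rabs_rprod_le_1 (f : nat -> R) (n : nat) :
  (forall j, (j < n)%nat -> Rabs (f j) <= 1) -> Rabs (rprod f n) <= 1.
Proof.
  induction n as [|n IH]; intros H; simpl; [rewrite Rabs_R1; lra|].
  rewrite Rabs_mult; rewrite <- (Rmult_1_l 1).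
  apply Rmult_le_compat; try apply Rabs_pos; [apply IH | apply H]; auto.
Qed.

Lemma rprod_0 (f : nat -> R) (j n : nat) : (j < n)%nat -> f j = 0 -> rprod f n = 0.
Proof.
  intros H Hj; induction n as [|n IH]; [lia|]; simpl.
  destruct (Nat.eq_dec j n) as [->|]; [rewrite Hj | rewrite IH by lia]; ring.
Qed.

Lemma RtoC_rprod_poch (f : nat -> R) (x y : R) (n : nat) : 0 < y ->
  (forall j, (j < n)%nat -> f j = (x + INR j) / (y + INR j)) ->
  RtoC (rprod f n) = (poch x n / poch y n)%C.
Proof.
  intros Hy; induction n as [|n IH]; intros H; simpl.
  - field; apply RtoC_neq_0; lra.
  - rewrite RtoC_mult, IH, H by auto.
    pose proof (pos_INR n).
    rewrite RtoC_div, !RtoC_plus by lra.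
    pose proof (poch_neq_0 y n (nonpos_int_pos y Hy)).
    assert (RtoC y + RtoC (INR n) <> RtoC 0)%C by (rewrite <- RtoC_plus; apply RtoC_neq_0; lra).
    field; auto.
Qed.

(* In [bailey] with [A = 1/2] the choices [N = m^2] and [c = N + 2 m + 5/2] make
   the weights on the left tend to [(-1)^n] and those on the right, multiplied
   by [4^r], decreasing in [r] with limit [1 / sqrt 2]. *)
Definition trunc (m : nat) : nat := (m * m)%nat.
Definition shift (m : nat) : R := INR m * INR m + 2 * INR m + 2.

Lemma INR_trunc (m : nat) : INR (trunc m) = INR m * INR m.
Proof. apply mult_INR. Qed.

Definition left_factor (m j : nat) : R :=
  (- INR (trunc m) + INR j) / (shift m + / 2 + INR j).

Lemma left_factor_lim (j : nat) : is_lim_seq (fun m => left_factor m j) (- 1).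
Proof.
  apply is_lim_seq_ext with
    (u := fun m => - 1 + (2 * INR m + 2 * INR j + 5 / 2) / (shift m + / 2 + INR j)).
  - intros m; unfold left_factor; rewrite INR_trunc; unfold shift.
    pose proof (pos_INR m); pose proof (pos_INR j).
    field; nra.
  - replace (Finite (- 1)) with (Finite (- 1 + 0)) by (f_equal; ring).
    apply is_lim_seq_plus'; [apply is_lim_seq_const|].
    apply is_lim_seq_le_le with (u := fun _ => 0) (w := fun m => (4 + 2 * INR j) * / INR (S m)).
    + intros m; pose proof (pos_INR m); pose proof (pos_INR j); unfold shift.
      assert (0 < INR m * INR m + 2 * INR m + 2 + / 2 + INR j) by nra.
      split; [apply Rdiv_le_0_compat; lra|].
      rewrite S_INR.
      apply Rmult_le_reg_r with (INR m * INR m + 2 * INR m + 2 + / 2 + INR j); [assumption|].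
      unfold Rdiv; rewrite Rmult_assoc, Rinv_l, Rmult_1_r by lra.
      apply Rmult_le_reg_l with (INR m + 1); [lra|].
      replace ((INR m + 1) * ((4 + 2 * INR j) * / (INR m + 1) * (INR m * INR m + 2 * INR m + 2 + / 2 + INR j)))
        with ((4 + 2 * INR j) * (INR m * INR m + 2 * INR m + 2 + / 2 + INR j)) by (field; lra).
      apply Rle_trans with ((4 + 2 * INR j) * ((INR m + 1) * (INR m + 1))); [|nra].
      rewrite (Rmult_comm (INR m + 1)), <- Rmult_assoc.
      apply Rmult_le_compat_r; [lra|]; nra.
    + apply is_lim_seq_const.
    + replace (Finite 0) with (Rbar_mult (Finite (4 + 2 * INR j)) (Finite 0)) by (simpl; f_equal; ring).
      apply is_lim_seq_scal_l, (is_lim_seq_incr_1 (fun n => / INR n)).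
      apply (is_lim_seq_inv _ p_infty); [apply is_lim_seq_INR | discriminate].
Qed.

Lemma Rabs_left_le_1 (m n : nat) : Rabs (rprod (left_factor m) n) <= 1.
Proof.
  destruct (Nat.le_gt_cases n (trunc m)) as [H|H].
  - apply Rabs_rprod_le_1; intros j Hj; unfold left_factor.
    assert (Hj' : INR j <= INR (trunc m)) by (apply le_INR; lia).
    rewrite INR_trunc in *; unfold shift.
    pose proof (pos_INR m); pose proof (pos_INR j).
    apply Rabs_le; split.
    + apply Rmult_le_reg_r with (INR m * INR m + 2 * INR m + 2 + / 2 + INR j); [nra|].
      unfold Rdiv; rewrite Rmult_assoc, Rinv_l; nra.
    + apply Rmult_le_reg_r with (INR m * INR m + 2 * INR m + 2 + / 2 + INR j); [nra|].
      unfold Rdiv; rewrite Rmult_assoc, Rinv_l; nra.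
  - rewrite (rprod_0 _ (trunc m) n H); [rewrite Rabs_R0; lra|].
    unfold left_factor, Rdiv; rewrite Rplus_opp_l; ring.
Qed.

Definition right_start_factor (m j : nat) : R :=
  (shift m + INR j) / (shift m + / 2 + INR j).
Definition right_start (m : nat) : R := rprod (right_start_factor m) (trunc m).

Definition right_factor (m i : nat) : R :=
  let s := INR (trunc m) - INR i in
  4 * s * (s + 2 * INR m + 1) / ((2 * s + 2 * INR m + 1) * (2 * s + 2 * INR m)).

Lemma right_start_bounds (m : nat) : 0 <= right_start m <= 1 /\
  1 / 2 <= right_start m * right_start m <= 1 / 2 + / INR (S m).
Proof.
  pose proof (pos_INR m) as Hm.
  assert (Hx : 2 <= shift m) by (unfold shift; nra).
  assert (K : forall n, 0 < rprod (right_start_factor m) n <= 1 /\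
    (shift m - / 2) / (shift m - / 2 + INR n) <= rprod (right_start_factor m) n * rprod (right_start_factor m) n
    <= shift m / (shift m + INR n)).
  { induction n as [|n IH].
    - simpl; rewrite !Rplus_0_r; split; [lra|]; split; right; field; lra.
    - destruct IH as [I1 [I2 I3]]; simpl rprod.
      pose proof (pos_INR n) as Hn; rewrite S_INR.
      set (P := rprod (right_start_factor m) n) in *.
      assert (Q : 0 < right_start_factor m n <= 1).
      { unfold right_start_factor; split; [apply Rdiv_lt_0_compat; lra|].
        apply Rmult_le_reg_r with (shift m + / 2 + INR n); [lra|].
        unfold Rdiv; rewrite Rmult_assoc, Rinv_l; lra. }
      split; [split; nra|].
      replace (P * right_start_factor m n * (P * right_start_factor m n))
        with ((P * P) * (right_start_factor m n * right_start_factor m n)) by ring.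
      assert (U : (shift m + INR n - / 2) / (shift m + INR n + / 2)
        <= right_start_factor m n * right_start_factor m n
        <= (shift m + INR n) / (shift m + INR n + 1)).
      { unfold right_start_factor; replace (shift m + / 2 + INR n) with (shift m + INR n + / 2) by ring.
        set (y := shift m + INR n) in *; assert (2 <= y) by (unfold y; lra).
        split.
        - apply Rmult_le_reg_r with ((y + / 2) * (y + / 2)); [nra|].
          replace ((y - / 2) / (y + / 2) * ((y + / 2) * (y + / 2))) with ((y - / 2) * (y + / 2)) by (field; lra).
          replace (y / (y + / 2) * (y / (y + / 2)) * ((y + / 2) * (y + / 2))) with (y * y) by (field; lra).
          nra.
        - apply Rmult_le_reg_r with ((y + / 2) * (y + / 2) * (y + 1)); [apply Rmult_lt_0_compat; nra|].
          replace (y / (y + / 2) * (y / (y + / 2)) * ((y + / 2) * (y + / 2) * (y + 1)))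
            with (y * (y * (y + 1))) by (field; lra).
          replace (y / (y + 1) * ((y + / 2) * (y + / 2) * (y + 1))) with (y * ((y + / 2) * (y + / 2))) by (field; lra).
          apply Rmult_le_compat_l; nra. }
      split.
      + replace ((shift m - / 2) / (shift m - / 2 + (INR n + 1))) with
          ((shift m - / 2) / (shift m - / 2 + INR n) * ((shift m + INR n - / 2) / (shift m + INR n + / 2)))
          by (field; lra).
        apply Rmult_le_compat; try lra; apply Rdiv_le_0_compat; lra.
      + replace (shift m / (shift m + (INR n + 1))) with
          (shift m / (shift m + INR n) * ((shift m + INR n) / (shift m + INR n + 1))) by (field; lra).
        apply Rmult_le_compat; try lra; nra. }
  destruct (K (trunc m)) as [K1 [K2 K3]]; fold (right_start m) in K1, K2, K3.
  rewrite INR_trunc in K2, K3; rewrite S_INR.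
  split; [lra|]; split.
  - eapply Rle_trans; [|exact K2].
    apply Rmult_le_reg_r with (shift m - / 2 + INR m * INR m); [nra|].
    unfold Rdiv; rewrite (Rmult_assoc (shift m - / 2)), Rinv_l by nra; unfold shift; nra.
  - eapply Rle_trans; [exact K3|].
    apply Rmult_le_reg_r with (shift m + INR m * INR m); [nra|].
    unfold Rdiv; rewrite (Rmult_assoc (shift m)), Rinv_l by nra.
    apply Rmult_le_reg_r with (INR m + 1); [lra|].
    replace ((1 * / 2 + / (INR m + 1)) * (shift m + INR m * INR m) * (INR m + 1))
      with ((INR m + 3) / 2 * (shift m + INR m * INR m)) by (field; lra).
    unfold shift; nra.
Qed.

Lemma right_start_lim : is_lim_seq right_start (/ sqrt 2).
Proof.
  apply is_lim_seq_ext with (u := fun m => sqrt (right_start m * right_start m)).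
  - intros m; apply sqrt_square, right_start_bounds.
  - rewrite <- sqrt_inv.
    apply is_lim_seq_continuous; [apply continuity_pt_sqrt; lra|].
    apply is_lim_seq_le_le with (u := fun _ => 1 / 2) (w := fun m => 1 / 2 + / INR (S m)).
    + intros m; apply right_start_bounds.
    + replace (/ 2) with (1 / 2) by field; apply is_lim_seq_const.
    + replace (/ 2) with (1 / 2 + 0) by field.
      apply is_lim_seq_plus'; [apply is_lim_seq_const|].
      apply (is_lim_seq_incr_1 (fun n => / INR n)).
      apply (is_lim_seq_inv _ p_infty); [apply is_lim_seq_INR | discriminate].
Qed.

Lemma right_factor_bounds (m i : nat) : (i < trunc m)%nat -> 0 <= right_factor m i <= 1.
Proof.
  intros Hi; apply lt_INR in Hi; unfold right_factor; cbv zeta.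
  rewrite INR_trunc in *; pose proof (pos_INR m); pose proof (pos_INR i).
  set (s := INR m * INR m - INR i) in *; assert (Hs : 0 < s) by (unfold s; lra).
  assert (D : 0 < (2 * s + 2 * INR m + 1) * (2 * s + 2 * INR m)) by (apply Rmult_lt_0_compat; lra).
  split.
  - apply Rdiv_le_0_compat; [|exact D]; apply Rmult_le_pos; lra.
  - apply Rmult_le_reg_r with (1 := D).
    unfold Rdiv; rewrite Rmult_assoc, Rinv_l, Rmult_1_r, Rmult_1_l by lra.
    assert (s <= INR m * INR m) by (unfold s; lra); nra.
Qed.

Lemma right_factor_lim (i : nat) : is_lim_seq (fun m => right_factor m i) 1.
Proof.
  apply is_lim_seq_le_le_loc with (u := fun m => 1 + - 2 * / INR m) (w := fun _ => 1).
  - exists (S i); intros m Hm.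
    assert (Hi : (i < trunc m)%nat) by (unfold trunc; nia).
    split; [|apply right_factor_bounds, Hi].
    apply lt_INR in Hi; rewrite INR_trunc in Hi.
    apply le_INR in Hm; rewrite S_INR in Hm.
    pose proof (pos_INR i); unfold right_factor; cbv zeta; rewrite INR_trunc.
    set (x := INR m) in *; set (s := x * x - INR i) in *; assert (Hs : 0 < s) by (unfold s; lra).
    assert (D : 0 < (2 * s + 2 * x + 1) * (2 * s + 2 * x)) by (apply Rmult_lt_0_compat; lra).
    apply Rmult_le_reg_r with (1 := D).
    unfold Rdiv; rewrite (Rmult_assoc (4 * s * _)), Rinv_l, Rmult_1_r by lra.
    apply Rmult_le_reg_r with x; [lra|].
    replace ((1 + - 2 * / x) * ((2 * s + 2 * x + 1) * (2 * s + 2 * x)) * x)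
      with ((x - 2) * ((2 * s + 2 * x + 1) * (2 * s + 2 * x))) by (field; lra).
    assert (Hsx : x * x <= s + x) by (unfold s; lra).
    assert (E : (2 * s + 2 * x + 1) * (2 * s + 2 * x) - 4 * s * (s + 2 * x + 1)
      = 4 * (x * x) + 2 * x - 2 * s) by ring.
    assert (B : x * (4 * (x * x) + 2 * x - 2 * s) <= 2 * ((2 * s + 2 * x + 1) * (2 * s + 2 * x))).
    { apply Rle_trans with (2 * ((2 * (x * x)) * (2 * (x * x)))).
      - assert (1 <= x) by lra.
        assert (x * (4 * (x * x) + 2 * x - 2 * s) <= x * (4 * (x * x) + 2 * x)) by nra.
        assert (x * (4 * (x * x) + 2 * x) <= 8 * (x * x) * (x * x)) by nra.
        nra.
      - apply Rmult_le_compat_l; [lra|]; apply Rmult_le_compat; nra. }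
    nra.
  - replace (Finite 1) with (Finite (1 + - 2 * 0)) by (f_equal; ring).
    apply is_lim_seq_plus'; [apply is_lim_seq_const|].
    apply (is_lim_seq_scal_l _ (- 2) 0).
    apply (is_lim_seq_inv _ p_infty); [apply is_lim_seq_INR | discriminate].
  - apply is_lim_seq_const.
Qed.

Lemma Rabs_right_le_1 (m n : nat) : Rabs (right_start m * rprod (right_factor m) n) <= 1.
Proof.
  rewrite Rabs_mult, <- (Rmult_1_l 1).
  destruct (right_start_bounds m) as [H _].
  apply Rmult_le_compat; try apply Rabs_pos; [rewrite Rabs_pos_eq; lra|].
  destruct (Nat.le_gt_cases n (trunc m)) as [Hn|Hn].
  - apply Rabs_rprod_le_1; intros j Hj.
    pose proof (right_factor_bounds m j ltac:(lia)); rewrite Rabs_pos_eq; lra.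
  - rewrite (rprod_0 _ (trunc m) n Hn); [rewrite Rabs_R0; lra|].
    unfold right_factor, Rdiv; cbv zeta; rewrite Rminus_diag; ring.
Qed.

Lemma RtoC_half : RtoC (1 / 2) = (1 / 2)%C.
Proof. apply RtoC_div; lra. Qed.

Lemma right_weight (m r : nat) : (r <= trunc m)%nat ->
  let c := RtoC (shift m + / 2) in
  (RtoC 4 ^ r * ((- (1)) ^ r * poch (- RtoC (INR (trunc m))) r
     * poch (c - 1 / 2 - RtoC (INR r)) (trunc m - r) / poch c (trunc m)))%C
  = RtoC (right_start m * rprod (right_factor m) r).
Proof.
  intros Hr c; pose proof (pos_INR m) as Hm.
  assert (N2 : RtoC 2 <> RtoC 0) by (apply RtoC_neq_0; lra).
  assert (Hx : 2 <= shift m) by (unfold shift; nra).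
  assert (Nc : poch c (trunc m) <> RtoC 0).
  { apply poch_neq_0, nonpos_int_pos; lra. }
  assert (Ec : (c - 1 / 2)%C = RtoC (shift m)).
  { unfold c; rewrite RtoC_plus, RtoC_inv by lra; field; auto. }
  induction r as [|r IH].
  - simpl rprod; rewrite Rmult_1_r; unfold right_start.
    rewrite (RtoC_rprod_poch _ (shift m) (shift m + / 2)) by (auto; lra).
    fold c; rewrite Ec; simpl.
    replace (shift m - 0)%C with (RtoC (shift m)) by ring.
    rewrite Nat.sub_0_r; field; auto.
  - simpl rprod; rewrite <- Rmult_assoc, RtoC_mult, <- IH by lia; clear IH.
    replace (trunc m - r)%nat with (S (trunc m - S r)) by lia.
    set (s' := (trunc m - S r)%nat).
    set (s := INR (trunc m) - INR r).
    assert (Hs : INR s' = s - 1).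
    { unfold s', s; rewrite minus_INR, S_INR by lia; ring. }
    assert (Hs1 : 0 < s).
    { unfold s; assert (INR r < INR (trunc m)) by (apply lt_INR; lia); lra. }
    rewrite Ec; set (x := (RtoC (shift m) - RtoC (INR r))%C).
    assert (Ex : x = RtoC (s + 2 * INR m + 2)).
    { unfold x; rewrite <- RtoC_minus; f_equal; unfold s, shift; rewrite INR_trunc; ring. }
    replace (RtoC (shift m) - RtoC (INR (S r)))%C with (x - 1)%C by (unfold x; rewrite RtoC_S; ring).
    assert (E : (poch (x - 1) s' * (x - 1 + RtoC (INR s')) * (x - 1 + RtoC (INR (S s')))
      = (x - 1) * poch x (S s'))%C).
    { replace x with (x - 1 + 1)%C at 5 by ring; rewrite <- poch_S_left; reflexivity. }
    rewrite RtoC_S, Hs in E.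
    assert (D1 : (x - 1 + RtoC (s - 1))%C = RtoC (2 * s + 2 * INR m)).
    { rewrite Ex, <- !RtoC_minus, <- RtoC_plus; f_equal; ring. }
    assert (D2 : (x - 1 + (RtoC (s - 1) + 1))%C = RtoC (2 * s + 2 * INR m + 1)).
    { rewrite Ex, <- RtoC_minus, <- !RtoC_plus; f_equal; ring. }
    assert (D3 : (x - 1)%C = RtoC (s + 2 * INR m + 1)).
    { rewrite Ex, <- RtoC_minus; f_equal; ring. }
    rewrite D1, D2 in E.
    assert (Hf : RtoC (right_factor m r) = (4 * RtoC s * RtoC (s + 2 * INR m + 1)
      / (RtoC (2 * s + 2 * INR m + 1) * RtoC (2 * s + 2 * INR m)))%C).
    { unfold right_factor; cbv zeta; fold s; rewrite RtoC_div, !RtoC_mult; [reflexivity|].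
      apply Rgt_not_eq, Rmult_lt_0_compat; lra. }
    rewrite Hf, <- D3.
    assert (M1 : RtoC (2 * s + 2 * INR m) <> RtoC 0) by (apply RtoC_neq_0; lra).
    assert (M2 : RtoC (2 * s + 2 * INR m + 1) <> RtoC 0) by (apply RtoC_neq_0; lra).
    replace (poch (x - 1) s') with ((x - 1) * poch x (S s')
      / (RtoC (2 * s + 2 * INR m) * RtoC (2 * s + 2 * INR m + 1)))%C
      by (rewrite <- E; field; auto).
    change (poch (- RtoC (INR (trunc m))) (S r))
      with (poch (- RtoC (INR (trunc m))) r * (- RtoC (INR (trunc m)) + RtoC (INR r)))%C.
    replace (- RtoC (INR (trunc m)) + RtoC (INR r))%C with (- RtoC s)%C
      by (unfold s; rewrite RtoC_minus; ring).
    change (RtoC 4 ^ S r)%C with (RtoC 4 * RtoC 4 ^ r)%C.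
    change ((- (1)) ^ S r)%C with ((- (1)) * (- (1)) ^ r)%C.
    set (X := poch x (S s')).
    field; auto.
Qed.

Lemma whipple_alternating (b s : C) :
  ~ nonpos_int (1 + b)%C -> ~ nonpos_int (1 - b)%C ->
  Clim (Csum (whipple_term (1 / 4) b (1 / 2))) s ->
  Clim (Csum (fun n => whipple_term (1 / 2 + b) b (1 / 2) n * RtoC ((-1) ^ n))%C)
    (s * RtoC (/ sqrt 2))%C.
Proof.
  intros H1 H2 Hs.
  assert (N2 : RtoC 2 <> RtoC 0) by (apply RtoC_neq_0; lra).
  assert (N4 : RtoC 4 <> RtoC 0) by (apply RtoC_neq_0; lra).
  assert (Ee : (RtoC (1 / 2) + 1 / 2 + b)%C = (1 + b)%C) by (rewrite RtoC_half; field; auto).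
  assert (Ef : (RtoC (1 / 2) + 1 / 2 - b)%C = (1 - b)%C) by (rewrite RtoC_half; field; auto).
  assert (He := H1); assert (Hf := H2); rewrite <- Ee in He; rewrite <- Ef in Hf.
  assert (Hh : 1 / 2 <= 1 / 2) by lra.
  assert (SA := ex_series_Cmod_whipple_term (1 / 2 + b) b (1 / 2) Hh He Hf).
  assert (SB := ex_series_Cmod_whipple_term (1 / 4) b (1 / 2) Hh He Hf).
  assert (P1 : forall n, Rabs ((-1) ^ n) <= 1) by (intros; right; apply pow_1_abs).
  assert (Hsqrt : 1 <= sqrt 2) by (rewrite <- sqrt_1 at 1; apply sqrt_le_1_alt; lra).
  destruct (ex_series_le (K := C_AbsRing) (V := C_CompleteNormedModule)
    (fun n => whipple_term (1 / 2 + b) b (1 / 2) n * RtoC ((-1) ^ n))%C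
    (fun n => Cmod (whipple_term (1 / 2 + b) b (1 / 2) n))) as [s1 Hs1].
  { intros n; change (Cmod (whipple_term (1 / 2 + b) b (1 / 2) n * RtoC ((-1) ^ n))
      <= Cmod (whipple_term (1 / 2 + b) b (1 / 2) n)).
    rewrite Cmod_mult, Cmod_R.
    pose proof (Cmod_ge_0 (whipple_term (1 / 2 + b) b (1 / 2) n)); specialize (P1 n); nra. }
  { exact SA. }
  apply is_series_Clim in Hs1.
  assert (Hs2 : Clim (Csum (fun n => whipple_term (1 / 4) b (1 / 2) n * RtoC (/ sqrt 2))%C)
    (s * RtoC (/ sqrt 2))%C).
  { apply Clim_ext with (u := fun n =>
      (Csum (whipple_term (1 / 4) b (1 / 2)) n * RtoC (/ sqrt 2))%C).
    - intros n; rewrite Cmult_comm, <- Csum_scal; apply Csum_ext; intros; ring.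
    - apply Clim_mult; [exact Hs | apply Clim_const]. }
  assert (HN : forall m, (m <= trunc m)%nat) by (intros; unfold trunc; nia).
  assert (T1 := tannery _ (fun m n => rprod (left_factor m) n) _ trunc s1 SA Rabs_left_le_1 P1
    (fun n => rprod_lim left_factor (-1) n left_factor_lim) HN Hs1).
  assert (T2 : Clim (fun m => Csum (fun n => whipple_term (1 / 4) b (1 / 2) n
      * RtoC (right_start m * rprod (right_factor m) n))%C (S (trunc m))) (s * RtoC (/ sqrt 2))%C).
  { apply (tannery _ (fun m n => right_start m * rprod (right_factor m) n) (fun _ => / sqrt 2)
      trunc _ SB Rabs_right_le_1); auto.
    - intros _; rewrite Rabs_pos_eq by (left; apply Rinv_0_lt_compat; lra).
      rewrite <- Rinv_1; apply Rinv_le_contravar; lra.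
    - intros n; replace (/ sqrt 2) with (/ sqrt 2 * 1 ^ n) by (rewrite pow1; ring).
      apply is_lim_seq_mult'; [apply right_start_lim | apply rprod_lim, right_factor_lim]. }
  replace (s * RtoC (/ sqrt 2))%C with s1; [exact Hs1|].
  apply (Clim_unique _ _ _ T1).
  apply Clim_ext with (2 := T2); intros m.
  pose proof (pos_INR m) as Hm.
  assert (Hc : 0 < shift m + / 2) by (unfold shift; nra).
  assert (EF : (1 + 1 / 2 - (1 / 2 + b))%C = (1 - b)%C) by (field; auto).
  assert (EG : (1 + 1 / 2 - (1 / 2 - b))%C = (1 + b)%C) by (field; auto).
  assert (EE : (1 + 1 / 2 - (1 / 2 + b) - (1 / 2 - b))%C = RtoC (1 / 2)).
  { rewrite RtoC_half; field; auto. }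
  assert (HF := H2); assert (HG := H1); rewrite <- EF in HF; rewrite <- EG in HG.
  assert (B := bailey (1 / 2) (1 / 2 + b) (1 / 2 - b) HF HG (trunc m) _ (nonpos_int_pos _ Hc)).
  rewrite EE, EF, EG in B.
  transitivity (Csum (fun r => poch (RtoC (1 / 2)) r / (poch 1 r * poch (1 - b) r * poch (1 + b) r)
    * poch (1 / 2) (2 * r) * ((- (1)) ^ r * poch (- RtoC (INR (trunc m))) r
    * poch (RtoC (shift m + / 2) - 1 / 2 - RtoC (INR r)) (trunc m - r)
    / poch (RtoC (shift m + / 2)) (trunc m)))%C (S (trunc m))).
  - apply Csum_ext; intros r Hr.
    rewrite <- right_weight by lia; cbv zeta; rewrite poch_double.
    unfold whipple_term; rewrite Ee, Ef.
    replace (1 / 2 / 2)%C with (1 / 4)%C by (field; auto).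
    replace ((1 / 2 + 1) / 2)%C with (1 - 1 / 4)%C by (field; auto).
    unfold Cdiv; rewrite !Cmult_assoc.
    replace (poch 1 r * poch (1 - b) r * poch (1 + b) r)%C
      with (poch 1 r * poch (1 + b) r * poch (1 - b) r)%C by ring.
    ring.
  - rewrite <- B; apply Csum_ext; intros n Hn.
    rewrite (RtoC_rprod_poch _ (- INR (trunc m)) (shift m + / 2)) by (auto; lra).
    unfold whipple_term; rewrite Ee, Ef, RtoC_opp, RtoC_half.
    replace (1 - (1 / 2 + b))%C with (1 / 2 - b)%C by (field; auto).
    replace (poch 1 n * poch (1 + b) n * poch (1 - b) n)%C
      with (poch 1 n * poch (1 - b) n * poch (1 + b) n)%C by ring.
    unfold Cdiv; ring.
Qed.

(** * Wallis' product and the duplication formula *)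

Definition wallis (n : nat) : R := RInt (fun x => sin x ^ n) 0 (PI / 2).

Lemma ex_wallis (n : nat) : ex_RInt (fun x => sin x ^ n) 0 (PI / 2).
Proof.
  apply (ex_RInt_continuous (V := R_CompleteNormedModule)); intros x _.
  apply (ex_derive_continuous (K := R_AbsRing) (V := R_NormedModule)); auto_derive; auto.
Qed.

Lemma wallis_0 : wallis 0 = PI / 2.
Proof. unfold wallis; simpl; rewrite RInt_const; unfold scal; simpl; unfold mult; simpl; ring. Qed.

Lemma wallis_1 : wallis 1 = 1.
Proof.
  unfold wallis; apply is_RInt_unique.
  replace 1 with (minus (- cos (PI / 2)) (- cos 0)).
  2: { rewrite cos_PI2, cos_0; unfold minus, plus, opp; simpl; ring. }
  apply (is_RInt_derive (V := R_CompleteNormedModule) (fun x => - cos x)).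
  - intros x _; auto_derive; [auto | ring].
  - intros x _; apply (ex_derive_continuous (K := R_AbsRing) (V := R_NormedModule)); auto_derive; auto.
Qed.

Lemma wallis_rec (n : nat) : (INR n + 2) * wallis (S (S n)) = (INR n + 1) * wallis n.
Proof.
  assert (H : is_RInt (fun x => (INR n + 1) * sin x ^ n - (INR n + 2) * sin x ^ S (S n)) 0 (PI / 2)
    (minus (cos (PI / 2) * sin (PI / 2) ^ S n) (cos 0 * sin 0 ^ S n))).
  { apply (is_RInt_derive (V := R_CompleteNormedModule) (fun x => cos x * sin x ^ S n)).
    - intros x _; auto_derive; [auto|].
      change (match n with O => 1 | S _ => INR n + 1 end) with (INR (S n)); rewrite S_INR.
      assert (E : sin x * sin x + cos x * cos x = 1) by apply sin2_cos2.
      apply Rminus_diag_uniq.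
      transitivity ((INR n + 1) * sin x ^ n * (sin x * sin x + cos x * cos x - 1));
        [simpl; ring | rewrite E; ring].
    - intros x _; apply (ex_derive_continuous (K := R_AbsRing) (V := R_NormedModule)); auto_derive; auto. }
  assert (H' : is_RInt (fun x => (INR n + 1) * sin x ^ n - (INR n + 2) * sin x ^ S (S n)) 0 (PI / 2)
    (minus (scal (INR n + 1) (wallis n)) (scal (INR n + 2) (wallis (S (S n)))))).
  { apply (is_RInt_minus (V := R_NormedModule));
      apply (is_RInt_scal (V := R_NormedModule)), (RInt_correct (V := R_CompleteNormedModule)), ex_wallis. }
  apply (is_RInt_unique (V := R_CompleteNormedModule)) in H.
  apply (is_RInt_unique (V := R_CompleteNormedModule)) in H'.
  rewrite H in H'; rewrite cos_PI2, sin_0 in H'.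
  unfold minus, plus, opp, scal in H'; simpl in H'; unfold mult in H'; simpl in H'.
  rewrite !Rmult_0_l, Rmult_0_r in H'; lra.
Qed.

Lemma wallis_decr (n : nat) : wallis (S n) <= wallis n.
Proof.
  pose proof PI_RGT_0.
  apply RInt_le; [lra | apply ex_wallis | apply ex_wallis |].
  intros x Hx; simpl.
  assert (0 < sin x) by (apply sin_gt_0; lra).
  assert (sin x <= 1) by apply SIN_bound.
  assert (0 < sin x ^ n) by (apply pow_lt; assumption); nra.
Qed.

Definition half_ratio (n : nat) : R := rprod (fun j => (1 / 2 + INR j) / (1 + INR j)) n.

Lemma half_ratio_pos (n : nat) : 0 < half_ratio n.
Proof.
  induction n as [|n IH]; unfold half_ratio in *; simpl; [lra|].
  apply Rmult_lt_0_compat; [exact IH|]; pose proof (pos_INR n); apply Rdiv_lt_0_compat; lra.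
Qed.

Lemma wallis_even (n : nat) : wallis (2 * n) = PI / 2 * half_ratio n.
Proof.
  induction n as [|n IH]; [simpl; rewrite wallis_0; unfold half_ratio; simpl; ring|].
  replace (2 * S n)%nat with (S (S (2 * n))) by lia.
  pose proof (wallis_rec (2 * n)) as R; rewrite IH, mult_INR in R; simpl (INR 2) in R.
  pose proof (pos_INR n); unfold half_ratio in *; simpl rprod.
  apply Rmult_eq_reg_l with ((1 + 1) * INR n + 2); [|lra].
  rewrite R; field; lra.
Qed.

Lemma wallis_odd (n : nat) : wallis (S (2 * n)) * half_ratio n * (2 * INR n + 1) = 1.
Proof.
  induction n as [|n IH]; [simpl; rewrite wallis_1; unfold half_ratio; simpl; ring|].
  replace (S (2 * S n)) with (S (S (S (2 * n)))) by lia.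
  pose proof (wallis_rec (S (2 * n))) as R; rewrite !S_INR, mult_INR in R; simpl (INR 2) in R.
  pose proof (pos_INR n); unfold half_ratio in *; simpl rprod; rewrite S_INR.
  set (p := rprod _ n) in *.
  replace (wallis (S (S (S (2 * n))))) with
    (((1 + 1) * INR n + 1 + 1) * wallis (S (2 * n)) / ((1 + 1) * INR n + 1 + 2))
    by (rewrite <- R; field; lra).
  transitivity (wallis (S (2 * n)) * p * (2 * INR n + 1)); [field; lra | exact IH].
Qed.

Lemma half_ratio_lim : is_lim_seq (fun n => INR (S n) * half_ratio (S n) * half_ratio (S n)) (/ PI).
Proof.
  pose proof PI_RGT_0 as HPI.
  apply is_lim_seq_le_le with (u := fun n => / PI - / PI * / INR (S n)) (w := fun _ => / PI).
  - intros n; set (k := S n).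
    pose proof (half_ratio_pos k) as Hp; set (p := half_ratio k) in *.
    assert (Hk : 1 <= INR k) by (unfold k; rewrite S_INR; pose proof (pos_INR n); lra).
    pose proof (wallis_even k) as We; pose proof (wallis_odd k) as Wo; fold p in We, Wo.
    pose proof (wallis_decr (2 * k)) as D1; rewrite We in D1.
    assert (D2 : wallis (2 * k) <= wallis (S (2 * n))).
    { replace (2 * k)%nat with (S (S (2 * n))) by (unfold k; lia); apply wallis_decr. }
    pose proof (wallis_rec (S (2 * n))) as R.
    replace (S (S (S (2 * n)))) with (S (2 * k)) in R by (unfold k; lia).
    assert (EI : INR (S (2 * n)) = 2 * INR k - 1).
    { unfold k; rewrite !S_INR, mult_INR; simpl (INR 2); ring. }
    rewrite EI in R; rewrite We in D2.
    set (w := wallis (S (2 * k))) in *; set (v := wallis (S (2 * n))) in *.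
    assert (K1 : 1 <= PI / 2 * p * p * (2 * INR k + 1)).
    { apply Rle_trans with (w * p * (2 * INR k + 1)); [lra|].
      apply Rmult_le_compat_r; [lra|]; apply Rmult_le_compat_r; lra. }
    assert (K2 : PI / 2 * p * p * (2 * INR k) <= 1).
    { apply Rle_trans with (w * p * (2 * INR k + 1)); [|lra].
      replace (w * p * (2 * INR k + 1)) with (v * p * (2 * INR k))
        by (replace (w * p * (2 * INR k + 1)) with (p * ((2 * INR k - 1 + 2) * w)) by ring; rewrite R; ring).
      apply Rmult_le_compat_r; [lra|]; apply Rmult_le_compat_r; lra. }
    assert (K3 : INR k * p * p * PI <= 1) by lra.
    split.
    + apply Rmult_le_reg_r with (PI * INR k); [nra|].
      replace ((/ PI - / PI * / INR k) * (PI * INR k)) with (INR k - 1) by (field; lra).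
      nra.
    + apply Rmult_le_reg_r with PI; [exact HPI|]; rewrite Rinv_l; lra.
  - replace (Finite (/ PI)) with (Finite (/ PI - / PI * 0)) by (f_equal; ring).
    apply is_lim_seq_minus'; [apply is_lim_seq_const|].
    apply (is_lim_seq_scal_l _ (/ PI) 0), (is_lim_seq_incr_1 (fun n => / INR n)).
    apply (is_lim_seq_inv _ p_infty); [apply is_lim_seq_INR | discriminate].
  - apply is_lim_seq_const.
Qed.

Lemma poch_1_fact (n : nat) : poch 1 n = RtoC (INR (fact n)).
Proof.
  induction n as [|n IH]; [reflexivity|].
  change (fact (S n)) with (S n * fact n)%nat; simpl poch.
  rewrite mult_INR, RtoC_mult, RtoC_S, IH; ring.
Qed.

Lemma rG_1 (n : nat) : rG 1 n = RtoC 1.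
Proof.
  unfold rG; rewrite poch_1_fact; replace (1 - 1)%C with (RtoC 0) by ring.
  rewrite Rpower_C_0; field; apply RtoC_fact_neq_0.
Qed.

Lemma rGamma_half_sqr : (rGamma (1 / 2) * rGamma (1 / 2))%C = RtoC (/ PI).
Proof.
  apply (Clim_unique (fun n => rG (1 / 2) n * rG (1 / 2) n)%C);
    [apply Clim_mult; apply rGamma_lim|].
  apply Clim_ext with (2 := Clim_RtoC _ _ half_ratio_lim); intros n.
  assert (N2 : RtoC 2 <> RtoC 0) by (apply RtoC_neq_0; lra).
  assert (H : RtoC (half_ratio (S n)) = (poch (1 / 2) (S n) / RtoC (INR (fact (S n))))%C).
  { unfold half_ratio; rewrite (RtoC_rprod_poch _ (1 / 2) 1) by (auto; lra).
    rewrite poch_1_fact, RtoC_div by lra; reflexivity. }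
  assert (P : 0 < INR (S n)) by (apply lt_0_INR; lia).
  rewrite !RtoC_mult; unfold rG; rewrite <- H.
  transitivity (Rpower_C (INR (S n)) ((1 - 1 / 2) + (1 - 1 / 2))
    * RtoC (half_ratio (S n)) * RtoC (half_ratio (S n)))%C.
  - replace ((1 - 1 / 2) + (1 - 1 / 2))%C with (RtoC 1) by (field; auto).
    rewrite Rpower_C_1 by exact P; reflexivity.
  - rewrite Rpower_C_plus; ring.
Qed.

Lemma rGamma_duplication (z : C) :
  (rGamma z * rGamma (z + 1 / 2) * Rpower_C 2 (1 - 2 * z) = rGamma (2 * z) * rGamma (1 / 2))%C.
Proof.
  assert (N2 : RtoC 2 <> RtoC 0) by (apply RtoC_neq_0; lra).
  apply (Clim_unique (fun n => rG z n * rG (z + 1 / 2) n * Rpower_C 2 (1 - 2 * z))%C).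
  { apply Clim_mult; [apply Clim_mult; apply rGamma_lim | apply Clim_const]. }
  assert (L := Clim_mult _ _ _ _
    (Clim_subseq _ _ (fun n => S (2 * n)) ltac:(intros; simpl; lia) (rGamma_lim (2 * z)))
    (rGamma_lim (1 / 2))).
  apply Clim_ext with (2 := L); intros n.
  transitivity (rG (2 * z) (S (2 * n)) * (rG (1 / 2) n * rG 1 n))%C; [rewrite rG_1; ring|].
  unfold rG.
  set (k := S n); replace (S (S (2 * n))) with (2 * k)%nat by (unfold k; lia).
  assert (Hk : 0 < INR k) by (apply lt_0_INR; unfold k; lia).
  assert (E1 := poch_double (2 * z) k); assert (E2 := poch_double 1 k).
  replace (2 * z / 2)%C with z in E1 by (field; auto).
  replace ((2 * z + 1) / 2)%C with (z + 1 / 2)%C in E1 by (field; auto).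
  replace ((1 + 1) / 2)%C with (RtoC 1) in E2 by (field; auto).
  assert (E3 := E2); rewrite poch_1_fact in E3.
  assert (N4 : (RtoC 4 ^ k)%C <> RtoC 0) by (apply Cpow_nz, RtoC_neq_0; lra).
  assert (F1 := RtoC_fact_neq_0 k); assert (F2 := RtoC_fact_neq_0 (2 * k)).
  replace (INR (2 * k)) with (2 * INR k) by (rewrite mult_INR; reflexivity).
  rewrite Rpower_C_mult by lra.
  assert (E4 : (Rpower_C (INR k) (1 - z) * Rpower_C (INR k) (1 - (z + 1 / 2)))%C
    = (Rpower_C (INR k) (1 - 2 * z) * (Rpower_C (INR k) (1 - 1 / 2) * Rpower_C (INR k) (1 - 1)))%C).
  { rewrite <- !Rpower_C_plus; f_equal; field; auto. }
  rewrite E1.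
  set (p1 := poch z k); set (p2 := poch (z + 1 / 2) k).
  set (R2 := Rpower_C 2 (1 - 2 * z)).
  transitivity (p1 * p2 / (RtoC (INR (fact k)) * RtoC (INR (fact k)))
    * (Rpower_C (INR k) (1 - z) * Rpower_C (INR k) (1 - (z + 1 / 2))) * R2)%C; [|field; auto].
  rewrite E4.
  transitivity (RtoC 4 ^ k * (poch (1 / 2) k * poch 1 k) / RtoC (INR (fact (2 * k)))
    * (p1 * p2 / (RtoC (INR (fact k)) * RtoC (INR (fact k)))
    * (Rpower_C (INR k) (1 - 2 * z) * (Rpower_C (INR k) (1 - 1 / 2) * Rpower_C (INR k) (1 - 1))) * R2))%C;
    [field; auto|].
  rewrite <- E3; field; auto.
Qed.

(** * The sum of the series *)

Lemma RtoC_sqrt2_sqr : (RtoC (sqrt 2) * RtoC (sqrt 2))%C = RtoC 2.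
Proof. rewrite <- RtoC_mult, sqrt_sqrt by lra; reflexivity. Qed.

Lemma Gamma_quarter : (rGamma (3 / 4) * rGamma (3 / 4) * (2 * PI * PI) = Gamma (1 / 4) * Gamma (1 / 4))%C.
Proof.
  assert (N2 : RtoC 2 <> RtoC 0) by (apply RtoC_neq_0; lra).
  assert (N4 : RtoC 4 <> RtoC 0) by (apply RtoC_neq_0; lra).
  pose proof PI_RGT_0.
  assert (NP : RtoC PI <> RtoC 0) by (apply RtoC_neq_0; lra).
  assert (H14 : ~ nonpos_int (1 / 4)%C).
  { rewrite <- RtoC_div by lra; apply nonpos_int_pos; lra. }
  assert (D := rGamma_duplication (1 / 4)).
  replace (1 / 4 + 1 / 2)%C with (3 / 4)%C in D by (field; auto).
  replace (2 * (1 / 4))%C with (1 / 2)%C in D by (field; auto).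
  rewrite rGamma_half_sqr, rGamma_eq in D by exact H14.
  replace (Rpower_C 2 (1 - 1 / 2)) with (RtoC (sqrt 2)) in D.
  2: { rewrite <- Rpower_sqrt, <- Rpower_C_RtoC by lra; f_equal.
       rewrite RtoC_inv by lra; field; auto. }
  pose proof (Gamma_neq_0 _ H14).
  assert (E : (rGamma (3 / 4) * RtoC (sqrt 2) * PI)%C = Gamma (1 / 4)).
  { transitivity (Gamma (1 / 4) * PI * (/ Gamma (1 / 4) * rGamma (3 / 4) * RtoC (sqrt 2)))%C;
      [field; auto|].
    rewrite D, RtoC_inv by lra; field; auto. }
  rewrite <- E, <- RtoC_sqrt2_sqr; ring.
Qed.

Lemma Gamma_four_halves (b : C) : ~ nonpos_int (1 + b)%C -> ~ nonpos_int (1 - b)%C ->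
  (Gamma ((1 + b) / 2) * Gamma ((1 + b + 1) / 2) * (Gamma ((1 - b) / 2) * Gamma ((1 - b + 1) / 2))
   = PI * (Gamma (1 + b) * Gamma (1 - b)))%C.
Proof.
  intros H1 H2.
  assert (N2 : RtoC 2 <> RtoC 0) by (apply RtoC_neq_0; lra).
  pose proof PI_RGT_0.
  assert (NP : RtoC PI <> RtoC 0) by (apply RtoC_neq_0; lra).
  destruct (half_nonpos_int _ H1) as [A1 A2]; destruct (half_nonpos_int _ H2) as [B1 B2].
  assert (D1 := rGamma_duplication ((1 + b) / 2)); assert (D2 := rGamma_duplication ((1 - b) / 2)).
  replace ((1 + b) / 2 + 1 / 2)%C with ((1 + b + 1) / 2)%C in D1 by (field; auto).
  replace ((1 - b) / 2 + 1 / 2)%C with ((1 - b + 1) / 2)%C in D2 by (field; auto).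
  replace (2 * ((1 + b) / 2))%C with (1 + b)%C in D1 by (field; auto).
  replace (2 * ((1 - b) / 2))%C with (1 - b)%C in D2 by (field; auto).
  assert (P : (Rpower_C 2 (1 - (1 + b)) * Rpower_C 2 (1 - (1 - b)))%C = RtoC 1).
  { rewrite <- Rpower_C_plus, <- (Rpower_C_0 2); f_equal; ring. }
  assert (HH := rGamma_half_sqr); rewrite RtoC_inv in HH by lra.
  rewrite !rGamma_eq in D1, D2 by assumption.
  pose proof (Gamma_neq_0 _ A1); pose proof (Gamma_neq_0 _ A2).
  pose proof (Gamma_neq_0 _ B1); pose proof (Gamma_neq_0 _ B2).
  pose proof (Gamma_neq_0 _ H1); pose proof (Gamma_neq_0 _ H2).
  set (X := (Gamma ((1 + b) / 2) * Gamma ((1 + b + 1) / 2) * (Gamma ((1 - b) / 2) * Gamma ((1 - b + 1) / 2)))%C).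
  set (Y := (PI * (Gamma (1 + b) * Gamma (1 - b)))%C).
  assert (E : (/ X)%C = (/ Y)%C).
  { unfold X, Y.
    transitivity ((/ Gamma ((1 + b) / 2) * / Gamma ((1 + b + 1) / 2) * Rpower_C 2 (1 - (1 + b)))
      * (/ Gamma ((1 - b) / 2) * / Gamma ((1 - b + 1) / 2) * Rpower_C 2 (1 - (1 - b))))%C.
    - transitivity (/ (Gamma ((1 + b) / 2) * Gamma ((1 + b + 1) / 2) *
        (Gamma ((1 - b) / 2) * Gamma ((1 - b + 1) / 2)))
        * (Rpower_C 2 (1 - (1 + b)) * Rpower_C 2 (1 - (1 - b))))%C; [rewrite P; ring|].
      field; auto.
    - rewrite D1, D2.
      transitivity (/ Gamma (1 + b) * / Gamma (1 - b) * (rGamma (1 / 2) * rGamma (1 / 2)))%C; [ring|].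
      rewrite HH; field; auto. }
  assert (NX : X <> RtoC 0) by (unfold X; repeat apply Cmult_neq_0; assumption).
  assert (NY : Y <> RtoC 0) by (unfold Y; repeat apply Cmult_neq_0; assumption).
  transitivity (X * (/ Y) * Y)%C; [field; auto | rewrite <- E; field; auto].
Qed.

Lemma Csum_even_part (t : nat -> C) (n : nat) :
  Csum (fun k => t (2 * k)%nat) n
  = (/ 2 * (Csum t (2 * n) + Csum (fun k => t k * RtoC ((-1) ^ k))%C (2 * n)))%C.
Proof.
  assert (N2 : RtoC 2 <> RtoC 0) by (apply RtoC_neq_0; lra).
  induction n as [|n IH]; [simpl; ring|].
  replace (2 * S n)%nat with (S (S (2 * n))) by lia.
  change (Csum (fun k => t (2 * k)%nat) (S n))
    with (Csum (fun k => t (2 * k)%nat) n + t (2 * n)%nat)%C.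
  change (Csum t (S (S (2 * n)))) with (Csum t (2 * n) + t (2 * n)%nat + t (S (2 * n)))%C.
  change (Csum (fun k => t k * RtoC ((-1) ^ k))%C (S (S (2 * n))))
    with (Csum (fun k => t k * RtoC ((-1) ^ k))%C (2 * n) + t (2 * n)%nat * RtoC ((-1) ^ (2 * n))
          + t (S (2 * n)) * RtoC ((-1) ^ S (2 * n)))%C.
  rewrite pow_1_even, pow_1_odd, IH; field; auto.
Qed.

Lemma hyp_term_even (a : C) (k : nat)
  (h1 : ~ nonpos_int (1 + a)%C) (h2 : ~ nonpos_int (1 - a)%C)
  (h3 : ~ nonpos_int (1 / 2 + a)%C) (h4 : ~ nonpos_int (1 / 2 - a)%C) :
  hyp_term
    [1 / 4; 3 / 4; 1 / 4 + a; 3 / 4 + a; 1 / 4 - a; 3 / 4 - a]%C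
    [RtoC 1; 1 / 2; 1 - a; 1 / 2 - a; 1 + a; 1 / 2 + a]%C (RtoC 1) k
  = whipple_term (1 / 2 + 2 * a) (2 * a) (1 / 2) (2 * k).
Proof.
  assert (N2 : RtoC 2 <> RtoC 0) by (apply RtoC_neq_0; lra).
  assert (N4 : RtoC 4 <> RtoC 0) by (apply RtoC_neq_0; lra).
  assert (H1 := nonpos_int_pos 1 Rlt_0_1).
  assert (H2 : ~ nonpos_int (1 / 2)%C).
  { rewrite <- RtoC_div by lra; apply nonpos_int_pos; lra. }
  unfold hyp_term, whipple_term, Cprod; cbn [map fold_right].
  rewrite RtoC_half.
  replace (1 / 2 + 1 / 2 + 2 * a)%C with (1 + 2 * a)%C by (field; auto).
  replace (1 / 2 + 1 / 2 - 2 * a)%C with (1 - 2 * a)%C by (field; auto).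
  replace (1 - (1 / 2 + 2 * a))%C with (1 / 2 - 2 * a)%C by (field; auto).
  rewrite !poch_double.
  replace ((1 / 2 + 2 * a) / 2)%C with (1 / 4 + a)%C by (field; auto).
  replace ((1 / 2 + 2 * a + 1) / 2)%C with (3 / 4 + a)%C by (field; auto).
  replace ((1 / 2 - 2 * a) / 2)%C with (1 / 4 - a)%C by (field; auto).
  replace ((1 / 2 - 2 * a + 1) / 2)%C with (3 / 4 - a)%C by (field; auto).
  replace (1 / 2 / 2)%C with (1 / 4)%C by (field; auto).
  replace ((1 / 2 + 1) / 2)%C with (3 / 4)%C by (field; auto).
  replace ((1 + 1) / 2)%C with (RtoC 1) by (field; auto).
  replace ((1 + 2 * a) / 2)%C with (1 / 2 + a)%C by (field; auto).
  replace ((1 + 2 * a + 1) / 2)%C with (1 + a)%C by (field; auto).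
  replace ((1 - 2 * a) / 2)%C with (1 / 2 - a)%C by (field; auto).
  replace ((1 - 2 * a + 1) / 2)%C with (1 - a)%C by (field; auto).
  replace (RtoC 1 ^ k)%C with (RtoC 1) by (rewrite <- RtoC_pow, pow1; reflexivity).
  assert (N4k : (RtoC 4 ^ k)%C <> RtoC 0) by (apply Cpow_nz, N4).
  pose proof (poch_neq_0 _ k H1); pose proof (poch_neq_0 _ k H2).
  pose proof (poch_neq_0 _ k h1); pose proof (poch_neq_0 _ k h2).
  pose proof (poch_neq_0 _ k h3); pose proof (poch_neq_0 _ k h4).
  set (P1 := poch 1 k) in *; set (P2 := poch (1 / 2) k) in *; set (P3 := poch (1 + a) k) in *;
  set (P4 := poch (1 - a) k) in *; set (P5 := poch (1 / 2 + a) k) in *; set (P6 := poch (1 / 2 - a) k) in *.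
  set (Q1 := poch (1 / 4) k); set (Q2 := poch (3 / 4) k); set (Q3 := poch (1 / 4 + a) k);
  set (Q4 := poch (3 / 4 + a) k); set (Q5 := poch (1 / 4 - a) k); set (Q6 := poch (3 / 4 - a) k).
  field; auto 10.
Qed.

Theorem corollary5p15 (a : C)
  (h1 : ~ nonpos_int (1 + a)%C) (h2 : ~ nonpos_int (1 - a)%C)
  (h3 : ~ nonpos_int (1 / 2 + a)%C) (h4 : ~ nonpos_int (1 / 2 - a)%C) :
  is_hyp
    [1 / 4; 3 / 4; 1 / 4 + a; 3 / 4 + a; 1 / 4 - a; 3 / 4 - a]%C
    [RtoC 1; 1 / 2; 1 - a; 1 / 2 - a; 1 + a; 1 / 2 + a]%C
    (RtoC 1)
    (Gamma (1 + 2 * a) * Gamma (1 - 2 * a) / (4 * PI)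
     * (Gamma (1 / 4) ^ 2 * rGamma (3 / 4 - 2 * a) * rGamma (3 / 4 + 2 * a)
        + sqrt 2 * PI ^ 2
          * rGamma (a + 5 / 8) * rGamma (a + 7 / 8)
          * rGamma (- a + 5 / 8) * rGamma (- a + 7 / 8)))%C.
Proof.
  assert (N2 : RtoC 2 <> RtoC 0) by (apply RtoC_neq_0; lra).
  assert (N4 : RtoC 4 <> RtoC 0) by (apply RtoC_neq_0; lra).
  assert (N8 : RtoC 8 <> RtoC 0) by (apply RtoC_neq_0; lra).
  pose proof PI_RGT_0.
  assert (NP : RtoC PI <> RtoC 0) by (apply RtoC_neq_0; lra).
  set (b := (2 * a)%C).
  assert (D : forall z, ~ nonpos_int (1 + z)%C -> ~ nonpos_int (1 / 2 + z)%C ->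
    ~ nonpos_int (1 + 2 * z)%C).
  { intros z Hz Hz2 [n Hn].
    destruct (Nat.Even_or_Odd n) as [[m ->]|[m ->]].
    - apply Hz2; exists m; rewrite RtoC_INR_double in Hn.
      replace (1 / 2 + z)%C with ((1 + 2 * z) / 2)%C by (field; auto).
      rewrite Hn; field; auto.
    - apply Hz; exists m; rewrite Nat.add_1_r, RtoC_S, RtoC_INR_double in Hn.
      replace (1 + z)%C with ((1 + 2 * z + 1) / 2)%C by (field; auto).
      rewrite Hn; field; auto. }
  assert (H1 : ~ nonpos_int (1 + b)%C) by (apply D; assumption).
  assert (H2 : ~ nonpos_int (1 - b)%C).
  { replace (1 - b)%C with (1 + 2 * - a)%C by (unfold b; ring); apply D; assumption. }
  assert (Ee : (RtoC (1 / 2) + 1 / 2 + b)%C = (1 + b)%C) by (rewrite RtoC_half; field; auto).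
  assert (Ef : (RtoC (1 / 2) + 1 / 2 - b)%C = (1 - b)%C) by (rewrite RtoC_half; field; auto).
  assert (He := H1); assert (Hf := H2); rewrite <- Ee in He; rewrite <- Ef in Hf.
  assert (W1 := whipple (1 / 2 + b) b (1 / 2) (Rle_refl _) He Hf).
  assert (W2 := whipple (1 / 4) b (1 / 2) (Rle_refl _) He Hf).
  cbv zeta in W1, W2; rewrite Ee, Ef, Gamma_four_halves in W1, W2 by assumption.
  apply whipple_alternating in W2; try assumption.
  assert (L := Clim_mult _ _ _ _ (Clim_const (/ 2)%C)
    (Clim_subseq _ _ (fun n => (2 * n)%nat) ltac:(intros; simpl; lia) (Clim_plus _ _ _ _ W1 W2))).
  apply is_series_Clim.
  match type of L with Clim _ ?l => match goal with |- Clim _ ?r => replace r with l end end.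
  - apply Clim_ext with (2 := L); intros n; cbv beta.
    rewrite <- Csum_even_part; apply Csum_ext; intros k _.
    rewrite hyp_term_even by assumption; reflexivity.
  - assert (G := Gamma_quarter).
    replace ((1 / 2 + b + (1 + b)) / 2)%C with (3 / 4 + b)%C by (field; auto).
    replace ((1 - (1 / 2 + b) + (1 + b)) / 2)%C with (3 / 4)%C by (field; auto).
    replace ((1 / 2 + b + (1 - b)) / 2)%C with (3 / 4)%C by (field; auto).
    replace ((1 - (1 / 2 + b) + (1 - b)) / 2)%C with (3 / 4 - b)%C by (field; auto).
    replace ((1 / 4 + (1 + b)) / 2)%C with (a + 5 / 8)%C by (unfold b; field; auto).
    replace ((1 - 1 / 4 + (1 + b)) / 2)%C with (a + 7 / 8)%C by (unfold b; field; auto).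
    replace ((1 / 4 + (1 - b)) / 2)%C with (- a + 5 / 8)%C by (unfold b; field; auto).
    replace ((1 - 1 / 4 + (1 - b)) / 2)%C with (- a + 7 / 8)%C by (unfold b; field; auto).
    assert (NS : RtoC (sqrt 2) <> RtoC 0).
    { apply RtoC_neq_0, Rgt_not_eq, sqrt_lt_R0; lra. }
    rewrite RtoC_inv by (apply Rgt_not_eq, sqrt_lt_R0; lra).
    replace (Gamma (1 / 4) ^ 2)%C with (Gamma (1 / 4) * Gamma (1 / 4))%C by (simpl; ring).
    rewrite <- G.
    replace (RtoC (sqrt 2)) with (RtoC 2 / RtoC (sqrt 2))%C at 2
      by (rewrite <- RtoC_sqrt2_sqr; field; auto).
    field; auto.
Qed.
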